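(* Let $K$ be a field, let $q\in K$ be nonzero and not a root of $1$, and let $R$ be any one of the following $K$-algebras (given by generators and relations): (i) $R$ generated by $x,y$ with $xy-qyx=1$; (ii) $R$ generated by $x,y,z$ with $xy-yx=y$, $xz-zx=0$, $yz-qzy=0$; (iii) $R$ generated by $x,y,z$ with $xy-qyx=z$, $xz-qzx=0$, $yz-q^{-1}zy=0$, where in this case $K$ has characteristic $0$; (iv) $R$ generated by $x,y,z$ with $xy-qyx=z$, $xz-q^{-1}zx=0$, $yz-qzy=0$; (v) $R$ generated by $x,y,z$ with $xy-qyx=\alpha yz+\beta y^2+\gamma y$, $xz=zx$, $yz=zy$, where $\alpha,\beta,\gamma\in K$. Let $G$ be a finite group of automorphisms of $R$. Then any crossed product $R*_tG$ is prime.
   Context: For a ring $R$ and a group $G$ of automorphisms of $R$, a crossed product $R*_tG$ is an associative ring that is a free left $R$-module with basis $\{\overline{g}\mid g\in G\}$ and multiplication determined by $\overline{g}\,r=g(r)\,\overline{g}$ and $\overline{g}\,\overline{h}=t(g,h)\,\overline{gh}$ for $r\in R$, $g,h\in G$, where $t:G\times G\to R^{\times}$ takes values in the units of $R$. *)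

(* Defs.v *)
From HB Require Import structures.
From mathcomp Require Import all_boot all_order all_algebra all_fingroup.
From mathcomp Require Export monalg.

Set Implicit Arguments.
Unset Strict Implicit.
Unset Printing Implicit Defensive.

Import GRing.Theory.
Local Open Scope ring_scope.

(* The free associative K-algebra on n generators is the monoid algebra of the
   free monoid {fmonom 'I_n}. *)
Definition free_alg (K : fieldType) (n : nat) : lalgType K :=
  {malg K[{fmonom 'I_n}]}.

Definition gen (K : fieldType) (n : nat) (i : 'I_n) : free_alg K n :=
  << fmu i >>.

Inductive in_ideal (A : nzRingType) (rels : seq A) : A -> Prop :=
| in_ideal0 : in_ideal rels 0
| in_idealD u v : in_ideal rels u -> in_ideal rels v -> in_ideal rels (u + v)
| in_idealM a r b : r \in rels -> in_ideal rels (a * r * b).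

(* R is isomorphic to K<X_1, ..., X_n> / (rels); a relation u = v is listed as
   the element u - v. *)
Definition presented_by (K : fieldType) (n : nat) (rels : seq (free_alg K n))
    (R : algType K) : Prop :=
  exists f : {lrmorphism free_alg K n -> R},
    (forall r : R, exists u, f u = r) /\
    (forall u, f u = 0 <-> in_ideal rels u).

Section Relations.
Variables (K : fieldType) (q : K).

Definition rels_i : seq (free_alg K 2) :=
  let x := gen K (@Ordinal 2 0 isT) in
  let y := gen K (@Ordinal 2 1 isT) in
  [:: x * y - q *: (y * x) - 1].

Let x := gen K (@Ordinal 3 0 isT).
Let y := gen K (@Ordinal 3 1 isT).
Let z := gen K (@Ordinal 3 2 isT).

Definition rels_ii : seq (free_alg K 3) :=
  [:: x * y - y * x - y; x * z - z * x; y * z - q *: (z * y)].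

Definition rels_iii : seq (free_alg K 3) :=
  [:: x * y - q *: (y * x) - z; x * z - q *: (z * x);
      y * z - q^-1 *: (z * y)].

Definition rels_iv : seq (free_alg K 3) :=
  [:: x * y - q *: (y * x) - z; x * z - q^-1 *: (z * x);
      y * z - q *: (z * y)].

Definition rels_v (alpha beta gamma : K) : seq (free_alg K 3) :=
  [:: x * y - q *: (y * x)
        - (alpha *: (y * z) + beta *: y ^+ 2 + gamma *: y);
      x * z - z * x; y * z - z * y].

End Relations.

(* A finite group of ring automorphisms of R, given as an abstract finite group
   gT with an injective homomorphism into Aut(R); that each act g is bijective
   follows from the first two fields. *)
Record automorphism_group (R : nzRingType) (gT : finGroupType)
    (act : gT -> {rmorphism R -> R}) : Prop := AutomorphismGroup {
  act_one : forall r, act 1%g r = r;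
  act_mul : forall g h r, act (g * h)%g r = act g (act h r);
  act_faithful : forall g h, (forall r, act g r = act h r) -> g = h
}.

(* A general nzRingType carries no GRing.unit predicate. *)
Definition invertible (R : nzRingType) (r : R) : Prop :=
  exists s : R, s * r = 1 /\ r * s = 1.

(* S is a crossed product R *_t G with basis bar.  The lalgType structure says
   that S is an associative ring and a left R-module with
   (r *: u) * v = r *: (u * v); an element r of R is viewed in S as
   r%:A = r *: 1. *)
Record crossed_product (R : nzRingType) (gT : finGroupType)
    (act : gT -> {rmorphism R -> R}) (t : gT -> gT -> R)
    (S : lalgType R) (bar : gT -> S) : Prop := CrossedProduct {
  twist_unit : forall g h, invertible (t g h);
  bar_basis : forall s : S,
    exists! c : {ffun gT -> R}, s = \sum_(g : gT) c g *: bar g;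
  bar_scalar : forall g r, bar g * r%:A = act g r *: bar g;
  bar_mul : forall g h, bar g * bar h = t g h *: bar (g * h)%g
}.

Definition prime_ring (S : nzRingType) : Prop :=
  forall a b : S, (forall s : S, a * s * b = 0) -> a = 0 \/ b = 0.

(* Main.v *)
Require Import Defs.
From HB Require Import structures.
From mathcomp Require Import all_boot all_order all_algebra all_fingroup.
From mathcomp Require Import finmap ring.

Set Implicit Arguments.
Unset Strict Implicit.
Unset Printing Implicit Defensive.

Import Order.TTheory GRing.Theory Num.Theory.
Local Open Scope ring_scope.

(** If R is a domain, the crossed product is prime as soon as no g <> 1 in the
    group admits nonzero a, b in R with a s b = b g(s) g(a) for all s: an element
    of minimal support in a nonzero ideal then lies in the base (ideal_meets_base),
    and the product of two nonzero base elements is nonzero.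

    The relation says that g is conjugation by b^-1 a in the division ring of
    fractions.  To exclude this for g of finite order, each of the algebras is
    embedded in a skew Laurent ring T over D = K[z][w] with variable y, where
    y z = q^L z y and y w = (q^P w + nu) y with P = 0 or nu = 0.  The generators
    y and z keep their names and x (in the last algebra, a translate of x) becomes
    xi y^-e, with e <= 1 and xi in D of degree 1 in w.  The algebra is spanned by
    the products y^i z^j x^k, and the map to T is injective because x^k has degree
    exactly k in w (iota_yzx_inj).

    Inside T, exponents of y and coefficients at the two ends are multiplicative.
    Comparing both sides of the relation for s homogeneous, g(s) is homogeneous of
    the same degree; and on elements of degree 0, g acts as the n-th power of
    conjugation by y, n being the difference of the top exponents of a and b
    (conj_fixes).  Each algebra has an element of degree 0, namely z or the one
    equal to w, which conjugation by y multiplies by a power of q with nonzero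
    exponent; since g has finite order and q is not a root of unity,
    n = 0 and g is trivial in degree 0.  Then g(y) = d y, where d is a quotient of
    coefficients that turns out to be a power of q (cocycle_scalar), hence 1 by
    finite order again.  So g fixes y and y^e x, thus x, and g = 1. *)

(** * Crossed products over domains *)

Section Ideals.
Variables (A : nzRingType).
Implicit Types (rels : seq A) (a b u v : A).

Lemma in_ideal_mem rels a : a \in rels -> in_ideal rels a.
Proof. by move/(in_idealM 1 1); rewrite mul1r mulr1. Qed.

Lemma in_ideal_mull rels a u : in_ideal rels u -> in_ideal rels (a * u).
Proof.
elim=> [|u' v _ IHu _ IHv|b r c rP]; first by rewrite mulr0; exact: in_ideal0.
  by rewrite mulrDr; exact: in_idealD.
by rewrite !mulrA; exact: in_idealM.
Qed.

Lemma in_ideal_mulr rels a u : in_ideal rels u -> in_ideal rels (u * a).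
Proof.
elim=> [|u' v _ IHu _ IHv|b r c rP]; first by rewrite mul0r; exact: in_ideal0.
  by rewrite mulrDl; exact: in_idealD.
by rewrite -mulrA; exact: in_idealM.
Qed.

Lemma in_idealB rels u v :
  in_ideal rels u -> in_ideal rels v -> in_ideal rels (u - v).
Proof.
by move=> Iu Iv; rewrite -mulN1r; apply/in_idealD/in_ideal_mull.
Qed.

(** Only products with one factor from S between a and b occur, since the ideals
    are generated by one element each. *)
Lemma mul_principal_ideals a b : (forall s, a * s * b = 0) ->
  forall u v, in_ideal [:: a] u -> in_ideal [:: b] v -> u * v = 0.
Proof.
move=> ab0 u v Iu Iv; elim: Iu => [|u1 u2 _ IH1 _ IH2|c r d]; first by rewrite mul0r.
  by rewrite mulrDl IH1 IH2 addr0.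
rewrite inE => /eqP->; elim: Iv => [|v1 v2 _ IH1 _ IH2|c' r' d']; first by rewrite mulr0.
  by rewrite mulrDr IH1 IH2 addr0.
rewrite inE => /eqP->.
by rewrite -!mulrA [d * _]mulrA [a * _]mulrA [a * _ * _]mulrA ab0 mul0r mulr0.
Qed.
End Ideals.

Section CrossedProduct.
Variables (R : nzRingType) (gT : finGroupType).
Variables (act : gT -> {rmorphism R -> R}) (t : gT -> gT -> R).
Variables (S : lalgType R) (bar : gT -> S).
Hypothesis (actG : automorphism_group act).
Hypothesis (S_cross : crossed_product act t bar).
Hypothesis R_domain : forall a b : R, a * b = 0 -> a = 0 \/ b = 0.
(* In the division ring of fractions of R the relation below says that g is
   conjugation by b^-1 a. *)
Hypothesis outer : forall g (a b : R), a != 0 -> b != 0 ->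
  (forall s, a * s * b = b * act g s * act g a) -> g = 1%g.

Implicit Types (c d : {ffun gT -> R}) (g h : gT) (r s : R).

Definition elt c : S := \sum_g c g *: bar g.

Lemma elt_inj : injective elt.
Proof.
move=> c d cd; have [e [_ e_uniq]] := bar_basis S_cross (elt c).
by rewrite -(e_uniq c)// -(e_uniq d).
Qed.

Lemma elt_surj (s : S) : exists c, s = elt c.
Proof. by have [c [cP _]] := bar_basis S_cross s; exists c. Qed.

Lemma elt_sub c d : elt c - elt d = elt [ffun g => c g - d g].
Proof.
by rewrite /elt -sumrB; apply: eq_bigr => g _; rewrite ffunE scalerBl.
Qed.

Lemma elt_scalel r c : r%:A * elt c = elt [ffun g => r * c g].
Proof.
rewrite mulr_sumr; apply: eq_bigr => g _.
by rewrite ffunE -scalerAl mul1r scalerA.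
Qed.

Lemma elt_scaler r c : elt c * r%:A = elt [ffun g => c g * act g r].
Proof.
rewrite mulr_suml; apply: eq_bigr => g _.
by rewrite ffunE -scalerAl (bar_scalar S_cross) scalerA.
Qed.

Lemma elt_shift c h :
  elt c * bar h = elt [ffun g => c (g * h^-1)%g * t (g * h^-1)%g h].
Proof.
rewrite mulr_suml (reindex_inj (mulIg h^-1)%g) /=; apply: eq_bigr => g _.
by rewrite ffunE -scalerAl (bar_mul S_cross) scalerA mulgKV.
Qed.

Lemma twist_neq0 g h : t g h != 0.
Proof.
have [u [tu _]] := twist_unit S_cross g h; apply/eqP => tgh.
by have := oner_eq0 R; rewrite -tu tgh mulr0 eqxx.
Qed.

Lemma R_mulf_neq0 r s : r != 0 -> s != 0 -> r * s != 0.
Proof.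
by move=> /eqP r0 /eqP s0; apply/eqP => /R_domain[].
Qed.

Definition carrier c : {set gT} := [set g | c g != 0].

Lemma carrier_shift c h :
  #|carrier [ffun g => c (g * h^-1)%g * t (g * h^-1)%g h]| = #|carrier c|.
Proof.
rewrite -[RHS](card_imset _ (mulIg h)%g); apply: eq_card => g.
rewrite inE ffunE; apply/idP/imsetP => [|[k]].
  move=> cg; exists (g * h^-1)%g; last by rewrite mulgKV.
  by rewrite inE; apply: contraNneq cg => ->; rewrite mul0r.
by rewrite inE => ck ->; rewrite mulgK R_mulf_neq0 ?twist_neq0.
Qed.

(** The usual minimal-support argument.  If u in I has minimal support
    containing 1, with coefficients d_g, then (d_1 s) u - u (s d_1) has no
    coefficient at 1, hence vanishes; its coefficient at g is the relation that
    outerness forbids for g <> 1.  Hence u is a multiple of bar 1.  The induction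
    on the size of the support only has to refute nonzero elements, because I is
    assumed to contain no nonzero multiple of bar 1. *)
Lemma ideal_meets_base (I : S -> Prop) :
    (forall u v, I u -> I v -> I (u - v)) ->
    (forall a u, I u -> I (a * u)) -> (forall a u, I u -> I (u * a)) ->
    (forall r, I (r *: bar 1%g) -> r = 0) ->
  forall u, I u -> u = 0.
Proof.
move=> Isub Imull Imulr Ibase u; have [c ->] := elt_surj u.
have [n] := ubnP #|carrier c|; elim: n => // n IHn in c *; rewrite ltnS => cn Ic.
have elt0 d : d =1 (fun _ => 0) -> elt d = 0.
  by move=> d0; rewrite /elt big1// => g _; rewrite d0 scale0r.
have [c0|/set0Pn[h]] := eqVneq (carrier c) set0.
  by apply: elt0 => g; move/setP/(_ g): c0; rewrite !inE; case: eqP.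
(* Right translation by bar h^-1 moves h to 1 in the support. *)
pose d : {ffun gT -> R} :=
  [ffun g => c (g * h^-1^-1)%g * t (g * h^-1^-1)%g h^-1%g].
have Id : I (elt d) by rewrite -elt_shift; exact: Imulr.
have dn : (#|carrier d| <= n)%N by rewrite carrier_shift.
rewrite inE => ch; have d1 : d 1%g != 0.
  by rewrite ffunE invgK mul1g R_mulf_neq0 ?twist_neq0.
suff supp1 g : d g != 0 -> g = 1%g.
  case/eqP: d1; apply: Ibase; move: Id.
  rewrite /elt (bigD1 1%g)//= big1 ?addr0// => g; apply: contraNeq => dg.
  by apply/eqP/supp1; apply: contraNneq dg => ->; rewrite scale0r.
move=> dg; apply: (outer (a := d 1%g) (b := d g)) => // s.
pose v : {ffun gT -> R} := [ffun g => d 1%g * s * d g - d g * act g (s * d 1%g)].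
have vE : elt v = (d 1%g * s)%:A * elt d - elt d * (s * d 1%g)%:A.
  rewrite elt_scalel elt_scaler elt_sub; congr elt.
  by apply/ffunP => k; rewrite !ffunE.
have v1 : v 1%g = 0 by rewrite ffunE (act_one actG) mulrA subrr.
have v0 : elt v = 0.
  apply: IHn; last by rewrite vE; apply: Isub; [exact: Imull|exact: Imulr].
  apply: leq_trans dn; apply: proper_card; apply/properP; split.
    apply/subsetP => k; rewrite !inE; apply: contraNneq => dk.
    by rewrite ffunE dk mulr0 mul0r subr0.
  by exists 1%g; rewrite inE ?d1// v1 eqxx.
have {}v0 : v = [ffun=> 0].
  by apply: elt_inj; rewrite v0 elt0// => k; rewrite ffunE.
move/ffunP/(_ g): v0; rewrite !ffunE => /eqP; rewrite subr_eq0 => /eqP->.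
by rewrite rmorphM mulrA.
Qed.

(** The ideals of a and b contain nonzero base elements r *: bar 1 and
    r' *: bar 1, whose product is a unit multiple of r r' *: bar 1. *)
Lemma crossed_product_prime : prime_ring S.
Proof.
have base_inj r : r *: bar 1%g = 0 -> r = 0.
  move=> r0; pose c : {ffun gT -> R} := [ffun g => if g == 1%g then r else 0].
  have: c = [ffun=> 0].
    apply: elt_inj; rewrite /elt [RHS]big1 => [|g _]; last by rewrite ffunE scale0r.
    rewrite (bigD1 1%g)//= ffunE eqxx r0 add0r big1// => g /negPf g1.
    by rewrite ffunE g1 scale0r.
  by move/ffunP/(_ 1%g); rewrite !ffunE eqxx.
move=> a b ab0; have [->|a0] := eqVneq a 0; first by left.
right; apply: (ideal_meets_base (I := in_ideal [:: b])).
- exact: in_idealB.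
- exact: in_ideal_mull.
- exact: in_ideal_mulr.
- move=> r Ir; apply/eqP; apply/negP => /negP r0; case/eqP: a0.
  apply: (ideal_meets_base (I := in_ideal [:: a])).
  + exact: in_idealB.
  + exact: in_ideal_mull.
  + exact: in_ideal_mulr.
  + move=> r' Ir'; have := mul_principal_ideals ab0 Ir' Ir.
    have -> : r *: bar 1%g = r%:A * bar 1%g by rewrite -scalerAl mul1r.
    rewrite -scalerAl mulrA (bar_scalar S_cross) (act_one actG) -scalerAl.
    rewrite (bar_mul S_cross) mulg1 !scalerA => /base_inj/eqP.
    by apply: contraTeq => r'0; rewrite R_mulf_neq0 ?twist_neq0// R_mulf_neq0.
  + by apply: in_ideal_mem; rewrite inE.
- by apply: in_ideal_mem; rewrite inE.
Qed.
End CrossedProduct.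

(** * Skew Laurent polynomial rings *)

Section LinearExtension.
Variables (D V : zmodType) (I : choiceType).
Variable F : I -> D -> V.
Hypothesis F_add : forall i, {morph F i : c d / c - d}.

(** Serves to define the twisted product by its values on monomials. *)
Definition lin_ext (g : {malg D[I]}) : V := \sum_(i <- msupp g) F i g@_i.

Lemma F_zero i : F i 0 = 0.
Proof. by rewrite -(subrr (0 : D)) F_add subrr. Qed.

Lemma lin_extEw (E : {fset I}) (g : {malg D[I]}) : (msupp g `<=` E)%fset ->
  lin_ext g = \sum_(i <- E) F i g@_i.
Proof.
move=> le; rewrite [LHS](big_fset_incl _ le) => //= i _ /mcoeff_outdom ->.
exact: F_zero.
Qed.

Lemma lin_extU i c : lin_ext << c *g i >> = F i c.
Proof. by rewrite (lin_extEw msuppU_le) big_seq_fset1 mcoeffUU. Qed.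

Lemma lin_extB : {morph lin_ext : f g / f - g}.
Proof.
move=> f g.
pose E := (msupp f `|` msupp g)%fset.
rewrite (@lin_extEw E (f - g)) ?msuppB_le//.
rewrite (@lin_extEw E f) ?fsubsetUl// (@lin_extEw E g) ?fsubsetUr//.
by rewrite -sumrB; apply: eq_bigr => i _; rewrite mcoeffB F_add.
Qed.
End LinearExtension.

Lemma malg_additive_ext (D V : zmodType) (I : choiceType)
    (A B : {malg D[I]} -> V) :
  {morph A : f g / f - g} -> {morph B : f g / f - g} ->
  (forall i c, A << c *g i >> = B << c *g i >>) -> A =1 B.
Proof.
move=> A_add B_add AB f.
pose mA := GRing.isZmodMorphism.Build _ _ A A_add.
pose mB := GRing.isZmodMorphism.Build _ _ B B_add.
pose A' : {additive _ -> _} := HB.pack A mA.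
pose B' : {additive _ -> _} := HB.pack B mB.
rewrite -[A f]/(A' f) -[B f]/(B' f) (monalgE f) !raddf_sum.
by apply: eq_bigr => i _; exact: AB.
Qed.

(** Negative exponents of the Laurent variable act as well, so an automorphism is
    given together with all its integer powers. *)
Record int_action (D : nzRingType) := IntAction {
  int_act :> int -> {rmorphism D -> D};
  int_act0 : forall d, int_act 0 d = d;
  int_actD : forall i j d, int_act (i + j) d = int_act i (int_act j d)
}.

(** Finite sums of d y^n with y d = tau 1 d y: only the additive structure is that
    of the monoid algebra, the product being twisted by tau. *)
Definition skew_laurent (D : nzRingType) (tau : int_action D) : Type :=
  {malg D[int]}.

Section SkewLaurentRing.
Variables (D : nzRingType) (tau : int_action D).
Local Notation T := (skew_laurent tau).
HB.instance Definition _ := GRing.Zmodule.copy T {malg D[int]}.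

(** The monomial d y^n. *)
Definition lau (d : D) (n : int) : T := << d *g n >>.

Definition lau_mull (i : int) (c : D) (g : T) : T :=
  lin_ext (fun j d => lau (c * tau i d) (i + j)) g.

Definition lau_mul (f g : T) : T := lin_ext (fun i c => lau_mull i c g) f.

Lemma lauB n : {morph lau^~ n : c d / c - d}.
Proof. exact: monalgUB. Qed.

Lemma coef_lau d n k : (lau d n)@_k = d *+ (n == k).
Proof. exact: mcoeffU. Qed.

Lemma lauD n : {morph lau^~ n : c d / c + d}.
Proof. exact: monalgUD. Qed.

Lemma lau_mull_addr i c : {morph lau_mull i c : f g / f - g}.
Proof. by apply: lin_extB => j d e; rewrite rmorphB mulrBr lauB. Qed.

Lemma lau_mull_addl i g : {morph (fun c => lau_mull i c g) : c d / c - d}.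
Proof.
move=> c d; apply: (malg_additive_ext (A := lau_mull i (c - d))
  (B := fun h => lau_mull i c h - lau_mull i d h)).
- exact: lau_mull_addr.
- by move=> f h; rewrite !lau_mull_addr !opprD !opprK addrACA.
move=> j e; rewrite /lau_mull !lin_extU; first by rewrite mulrBl lauB.
all: by move=> k x y; rewrite rmorphB mulrBr lauB.
Qed.

Lemma lau_mul_addl h : {morph lau_mul^~ h : f g / f - g}.
Proof. by apply: lin_extB => i; exact: lau_mull_addl. Qed.

Lemma lau_mullU i j c d : lau_mull i c (lau d j) = lau (c * tau i d) (i + j).
Proof. by rewrite /lau_mull lin_extU// => k x y; rewrite rmorphB mulrBr lauB. Qed.

Lemma lau_mulUl i c g : lau_mul (lau c i) g = lau_mull i c g.
Proof. by rewrite /lau_mul lin_extU// => k; exact: lau_mull_addl. Qed.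

Lemma lau_mul_addr f : {morph lau_mul f : g h / g - h}.
Proof.
move=> g h; pose A f := lau_mul f (g - h).
apply: (malg_additive_ext (A := A) (B := fun f => lau_mul f g - lau_mul f h)).
- exact: lau_mul_addl.
- by move=> u v; rewrite !lau_mul_addl !opprD !opprK addrACA.
by move=> i c; rewrite /A !lau_mulUl lau_mull_addr.
Qed.

Lemma lau_mulUU i j c d :
  lau_mul (lau c i) (lau d j) = lau (c * tau i d) (i + j).
Proof. by rewrite lau_mulUl lau_mullU. Qed.

Lemma lau_mulA : associative lau_mul.
Proof.
move=> f g h; move: f; apply: malg_additive_ext => [||i c].
- exact: lau_mul_addl.
- by move=> u v; rewrite !lau_mul_addl.
move: g; apply: malg_additive_ext => [||j d].
- by move=> u v; rewrite lau_mul_addl lau_mul_addr.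
- by move=> u v; rewrite lau_mul_addr lau_mul_addl.
move: h; apply: malg_additive_ext => [||k e].
- by move=> u v; rewrite !lau_mul_addr.
- by move=> u v; rewrite lau_mul_addr.
by rewrite !lau_mulUU rmorphM -int_actD mulrA addrA.
Qed.

Lemma lau_mul1l : left_id (lau 1 0) lau_mul.
Proof.
apply: malg_additive_ext => [||i c]; [exact: lau_mul_addr|by []|].
by rewrite lau_mulUU int_act0 mul1r add0r.
Qed.

Lemma lau_mul1r : right_id (lau 1 0) lau_mul.
Proof.
apply: malg_additive_ext => [||i c]; [exact: lau_mul_addl|by []|].
by rewrite lau_mulUU rmorph1 mulr1 addr0.
Qed.

Lemma lau_mulDl : left_distributive lau_mul +%R.
Proof.
by move=> f g h; rewrite -[g in LHS]opprK lau_mul_addl -[- g]sub0r lau_mul_addl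
  -{1}(subrr f) lau_mul_addl subrr sub0r opprK.
Qed.

Lemma lau_mulDr : right_distributive lau_mul +%R.
Proof.
by move=> h f g; rewrite -[g in LHS]opprK lau_mul_addr -[- g]sub0r lau_mul_addr
  -{1}(subrr f) lau_mul_addr subrr sub0r opprK.
Qed.

Lemma lau1_neq0 : lau 1 0 != 0.
Proof. by rewrite monalgU_eq0 oner_eq0. Qed.

HB.instance Definition _ := GRing.Zmodule_isNzRing.Build T
  lau_mulA lau_mul1l lau_mul1r lau_mulDl lau_mulDr lau1_neq0.

Lemma lauM i j c d : lau c i * lau d j = lau (c * tau i d) (i + j).
Proof. exact: lau_mulUU. Qed.

Definition lau_const (d : D) : T := lau d 0.

Lemma lau_const_zmod_morphism : zmod_morphism lau_const.
Proof. exact: lauB. Qed.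
HB.instance Definition _ := GRing.isZmodMorphism.Build D T lau_const
  lau_const_zmod_morphism.

Lemma lau_const_monoid_morphism : monoid_morphism lau_const.
Proof. by split=> // c d; rewrite /lau_const lauM addr0 int_act0. Qed.
HB.instance Definition _ := GRing.isMonoidMorphism.Build D T lau_const
  lau_const_monoid_morphism.

Lemma lau_constM c d n : lau_const c * lau d n = lau (c * d) n.
Proof. by rewrite /lau_const lauM add0r int_act0. Qed.

Lemma lau_const_central c (f : T) : (forall n, tau n c = c) ->
  (forall d, c * d = d * c) -> lau_const c * f = f * lau_const c.
Proof.
move=> c_fixed c_central.
apply: (malg_additive_ext (A := fun f : T => (lau_const c * f : T))
  (B := fun f : T => (f * lau_const c : T))) => [u v|u v|i d].
- exact: mulrBr.
- exact: mulrBl.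
rewrite -[<< d *g i >>]/(lau d i) lau_constM /lau_const lauM.
by rewrite addr0 c_fixed c_central.
Qed.

(** Right multiplication by a monomial only shifts exponents, so a coefficient of
    such a product is a single term. *)
Lemma coef_lau_mulr (f : T) d m n : (f * lau d m)@_(n + m) = f@_n * tau n d.
Proof.
pose A (f : T) := (f * lau d m)@_(n + m); pose B (f : T) := f@_n * tau n d.
apply: (malg_additive_ext (A := A) (B := B)) => [||i c].
- by move=> u v; rewrite /A mulrBl mcoeffB.
- by move=> u v; rewrite /B mcoeffB mulrBl.
rewrite /A /B -[<< c *g i >>]/(lau c i) lauM /lau !mcoeffU.
by rewrite (inj_eq (addIr m)); case: eqP => [->|_]; rewrite ?mul0r.
Qed.
End SkewLaurentRing.

Section LeadingTerms.
Variables (D : idomainType) (tau : int_action D).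
Local Notation T := (skew_laurent tau).
Implicit Types (e i m n : int) (f g : T).

Lemma int_act_eq0 n d : (tau n d == 0) = (d == 0).
Proof.
apply/eqP/eqP => [/(congr1 (tau (- n)))|->]; last exact: rmorph0.
by rewrite -int_actD addNr int_act0 rmorph0.
Qed.

Lemma coef_lauM f g k :
  (f * g)@_k = \sum_(i <- msupp f) f@_i * tau i g@_(k - i).
Proof.
rewrite {1}[f](monalgE f) mulr_suml raddf_sum; apply: eq_bigr => i _ /=.
pose c := f@_i; rewrite -/c.
pose A (g : T) := (lau tau c i * g)@_k; pose B (g : T) := c * tau i g@_(k - i).
apply: (malg_additive_ext (A := A) (B := B)) => [||j d].
- by move=> u v; rewrite /A mulrBr mcoeffB.
- by move=> u v; rewrite /B mcoeffB rmorphB mulrBr.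
rewrite /A /B -[<< d *g j >>]/(lau tau d j) lauM /lau !mcoeffU.
rewrite -(inj_eq (addrI i) j) addrCA subrr addr0.
by case: eqP => _; rewrite ?rmorph0 ?mulr0.
Qed.

(** The scalar e selects the end: n is the top exponent of f for e = 1 and the
    bottom one for e = -1, so that every statement covers both ends. *)
Definition lead e f n : Prop :=
  f@_n != 0 /\ forall i, f@_i != 0 -> e * i <= e * n.

Lemma lead_exists e f : f != 0 -> exists n, lead e f n.
Proof.
move=> f_neq0.
have [n n_f] : exists n, n \in msupp f.
  case E : (enum_fset (msupp f)) => [|n s].
    case/eqP: f_neq0; rewrite (monalgE f).
    by rewrite [X in \sum_(_ <- X) _](_ : _ = [::]) ?big_nil.
  by exists n; rewrite -[_ \in _]/(n \in enum_fset _) E mem_head.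
have max_seq (s : seq int) : n \in s ->
    exists2 k, k \in s & forall i, i \in s -> e * i <= e * k.
  elim: s n {n_f} => // a s IHs n _.
  case: s IHs => [_|b s /(_ b (mem_head b s)) [k ks k_max]].
    by exists a => [|i]; rewrite ?mem_head// inE => /eqP->.
  have [ak|ka] := leP (e * a) (e * k).
    exists k => [|i]; first by rewrite inE ks orbT.
    by rewrite inE => /predU1P[->//|/k_max].
  exists a => [|i]; first exact: mem_head.
  by rewrite inE => /predU1P[->//|/k_max/le_trans->//]; exact: ltW.
have [k kf k_max] := max_seq _ n_f.
exists k; split=> [|i]; first by rewrite mcoeff_neq0.
by rewrite mcoeff_neq0; exact: k_max.
Qed.

Lemma lead_uniq e f m n : e != 0 -> lead e f m -> lead e f n -> m = n.
Proof.
move=> e0 [fm fm_max] [fn fn_max]; apply: (mulfI e0); apply: le_anti.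
by rewrite fn_max// fm_max.
Qed.

Lemma lead_lau e d n : d != 0 -> lead e (lau tau d n) n.
Proof.
move=> d0; split=> [|i]; first by rewrite mcoeffUU.
by rewrite mcoeffU; case: (eqVneq n i) => [->|]; rewrite ?eqxx.
Qed.

Lemma coef_leadM e f g m n : e != 0 -> lead e f m -> lead e g n ->
  (f * g)@_(m + n) = f@_m * tau m g@_n.
Proof.
move=> e0 [fm fm_max] [gn gn_max].
have mf : m \in msupp f by rewrite -mcoeff_neq0.
rewrite coef_lauM (big_fsetD1 m)//= [m + n]addrC addrK big1_fset ?addr0// => i.
rewrite in_fsetD1 => /andP[im]; rewrite -mcoeff_neq0 => fi _.
have [->|/gn_max] := eqVneq g@_(n + m - i) 0; first by rewrite rmorph0 mulr0.
rewrite -addrA mulrDr gerDl mulrBr subr_le0 => mi.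
by case/eqP: im; apply: (mulfI e0); apply: le_anti; rewrite mi fm_max.
Qed.

Lemma leadM e f g m n : e != 0 -> lead e f m -> lead e g n ->
  lead e (f * g) (m + n).
Proof.
move=> e0 lf lg; have fg := coef_leadM e0 lf lg.
case: lf lg => [fm fm_max] [gn gn_max]; split=> [|k].
  by rewrite fg mulf_neq0 ?int_act_eq0.
rewrite coef_lauM; apply: contraNT; rewrite -ltNge => k_gt.
apply/eqP; rewrite big_seq big1// => i; rewrite -mcoeff_neq0 => /fm_max im.
have [->|/gn_max] := eqVneq g@_(k - i) 0; first by rewrite rmorph0 mulr0.
rewrite leNgt mulrBr => /negP[]; rewrite ltrBrDl.
by apply: le_lt_trans k_gt; rewrite mulrDr lerD2r.
Qed.

Lemma lead_two_sided f n : lead 1 f n -> lead (- 1) f n -> f = lau tau f@_n n.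
Proof.
move=> [fn fn_max] [_ fn_min]; apply/malgP => i; rewrite mcoeffU.
have [<-//|ni] := eqVneq n i; apply/eqP; apply: contraNT ni => fi.
have := fn_max _ fi; have := fn_min _ fi; rewrite !mul1r !mulN1r lerN2 => ? ?.
by apply/eqP/le_anti/andP.
Qed.

Lemma skew_laurent_domain f g : f * g = 0 -> f = 0 \/ g = 0.
Proof.
move=> fg0; have [->|f0] := eqVneq f 0; first by left.
have [->|g0] := eqVneq g 0; first by right.
have [[m lf] [n lg]] := (lead_exists 1 f0, lead_exists 1 g0).
by have [] := leadM (oner_neq0 _) lf lg; rewrite fg0 mcoeff0 eqxx.
Qed.
End LeadingTerms.

(** * Algebras given by generators and relations *)

Section FreeAlgebra.
Variables (K : fieldType) (n : nat).

Lemma gen_word (i : 'I_n) (w : {fmonom 'I_n}) :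
  gen K i * << w >> = << FMonom (i :: w) >> :> free_alg K n.
Proof.
rewrite /gen [LHS](@fgmulUU _ K) mulr1; congr mkmalgU; apply/eqP.
by rewrite fmP fmM fmU.
Qed.

(** A K-subspace containing 1 and stable under left multiplication by the
    generators contains every word, hence is everything. *)
Lemma free_alg_gen_ind (P : free_alg K n -> Prop) :
  P 1 -> (forall u v, P u -> P v -> P (u + v)) ->
  (forall k u, P u -> P (k *: u)) -> (forall i u, P u -> P (gen K i * u)) ->
  forall u, P u.
Proof.
move=> P1 PD PZ Pg u.
have P0 : P 0 by rewrite -(scale0r 1); exact: PZ.
have Pw (w : {fmonom 'I_n}) : P << w >>.
  case: w; elim=> [|i s IHs]; last by rewrite -(gen_word i (FMonom s)); exact: Pg.
  suff -> : << FMonom [::] >> = 1 :> free_alg K n by [].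
  by rewrite -[LHS]/(<< _ >>); congr mkmalgU; apply/eqP; rewrite fmP fm1.
have PU k (w : {fmonom 'I_n}) : P << k *g w >>.
  rewrite (_ : << k *g w >> = k *: (<< w >> : free_alg K n)); first exact: PZ.
  rewrite -[RHS]/(k *: (<< w >> : {malg K[{fmonom 'I_n}]})).
  by apply/malgP => v; rewrite mcoeffZ !mcoeffU mulrnAr mulr1.
rewrite [u](@monalgE _ K u); elim: (enum_fset _) => [|w s IHs].
  by rewrite big_nil; exact: P0.
by rewrite big_cons; exact: (PD _ _ (PU _ _) IHs).
Qed.

Section Lift.
Variables (A : nzRingType) (c : {rmorphism K -> A}) (v : 'I_n -> A).
Hypothesis c_comm : forall k i, c k * v i = v i * c k.

Definition word_eval (w : {fmonom 'I_n}) : A := \prod_(i <- w) v i.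

Lemma word_eval_mmorphism : mmorphism word_eval.
Proof.
by split=> [w w'|]; rewrite /word_eval ?fm1 ?big_nil// fmM big_cat.
Qed.
HB.instance Definition _ := monalg.isMultiplicative.Build _ A word_eval
  word_eval_mmorphism.

Lemma word_eval_comm k w : GRing.comm (c k) (word_eval w).
Proof. by apply: commr_prod => i _; exact: c_comm. Qed.

Lemma free_alg_lift : exists phi : {rmorphism free_alg K n -> A},
  (forall i, phi (gen K i) = v i) /\
  forall k u, phi (k *: u) = c k * phi u.
Proof.
pose phi0 : free_alg K n -> A := mmap c word_eval.
have phi0M : monoid_morphism phi0.
  have [M1 M2] := commr_mmap_is_multiplicative (f := c) (h := word_eval)
     (fun g m m' => word_eval_comm (g@_m) m').
  by split.
have phi0B : zmod_morphism phi0 by exact: mmap_is_additive.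
pose mB := GRing.isZmodMorphism.Build _ _ phi0 phi0B.
pose mM := GRing.isMonoidMorphism.Build _ _ phi0 phi0M.
pose phi : {rmorphism _ -> _} := HB.pack phi0 mB mM.
exists phi; split=> [i|k u].
  by rewrite -[LHS]/(mmap c word_eval _) mmapU /= (rmorph1 c) mul1r /word_eval fmU big_seq1.
exact: mmapZ.
Qed.
End Lift.
End FreeAlgebra.

Section Presentation.
Variables (K : fieldType) (n : nat) (rels : seq (free_alg K n)) (R : algType K).
Variable f : {lrmorphism free_alg K n -> R}.
Hypothesis f_surj : forall r : R, exists u, f u = r.
Hypothesis f_ker : forall u, f u = 0 <-> in_ideal rels u.

Lemma presented_gen_ind (P : R -> Prop) :
  P 1 -> (forall u v, P u -> P v -> P (u + v)) ->
  (forall k u, P u -> P (k *: u)) -> (forall i u, P u -> P (f (gen K i) * u)) ->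
  forall r, P r.
Proof.
move=> P1 PD PZ Pg r; have [u <-] := f_surj r; move: u.
apply: free_alg_gen_ind => [|u v|k u|i u]; rewrite ?rmorph1 ?rmorphD ?linearZ ?rmorphM//.
- exact: PD.
- exact: PZ.
- exact: Pg.
Qed.

Lemma presented_rel r : r \in rels -> f r = 0.
Proof. by move=> rP; apply/f_ker; rewrite -[r]mul1r -[_ * r]mulr1; apply: in_idealM. Qed.

(** The universal property of the quotient.  As R is only known to be isomorphic
    to the quotient, preimages under f have to be chosen; the result does not
    depend on the choice since phi kills the kernel of f. *)
Lemma presented_lift (A : nzRingType) (phi : {rmorphism free_alg K n -> A}) :
  (forall r, r \in rels -> phi r = 0) ->
  exists iota : {rmorphism R -> A}, forall u, iota (f u) = phi u.
Proof.
move=> phi_rels.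
have phi_ker u : f u = 0 -> phi u = 0.
  move/f_ker; elim=> [|u' v _ u0 _ v0|a r b /phi_rels r0]; first exact: rmorph0.
    by rewrite rmorphD u0 v0 addr0.
  by rewrite !rmorphM r0 mulr0 mul0r.
have f_surjb r : exists u, f u == r by have [u /eqP] := f_surj r; exists u.
pose iota0 r := phi (xchoose (f_surjb r)).
have iota0E u : iota0 (f u) = phi u.
  apply/eqP; rewrite -subr_eq0 -rmorphB; apply/eqP/phi_ker.
  by rewrite rmorphB; apply/eqP; rewrite subr_eq0; exact: (xchooseP (f_surjb (f u))).
have iota0B : zmod_morphism iota0.
  move=> r s; have [[u <-] [v <-]] := (f_surj r, f_surj s).
  by rewrite -rmorphB !iota0E rmorphB.
have iota0M : monoid_morphism iota0.
  split; first by rewrite -(rmorph1 f) iota0E rmorph1.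
  move=> r s; have [[u <-] [v <-]] := (f_surj r, f_surj s).
  by rewrite -rmorphM !iota0E rmorphM.
pose mB := GRing.isZmodMorphism.Build _ _ iota0 iota0B.
pose mM := GRing.isMonoidMorphism.Build _ _ iota0 iota0M.
pose iota : {rmorphism _ -> _} := HB.pack iota0 mB mM.
by exists iota.
Qed.
End Presentation.

(** * Automorphisms of K[z][w] scaling z and moving w affinely *)

Section AffineAction.
Variables (K : fieldType) (q : K) (L P : int) (nu : K).
Hypothesis q_neq0 : q != 0.
Hypothesis P_or_nu : P = 0 \/ nu = 0.

Local Notation D := {poly {poly K}}.

Definition zscale (n : int) : {poly K} -> {poly K} :=
  comp_poly (q ^ (L * n) *: 'X).
HB.instance Definition _ n := GRing.RMorphism.on (zscale n).

(** The image of w under the n-th power of the automorphism.  Powers of an affine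
    map have this simple closed form when it is a scaling or a translation, and
    no other case is needed below: a fixed point can be moved to 0. *)
Definition waff (n : int) : D := (q ^ (P * n))%:P *: 'X + (nu *~ n)%:P%:P.

(** The automorphism of K[z][w] with z -> q^(L n) z and w -> waff n, where w is
    the outer variable 'X and z the inner variable 'X%:P. *)
Definition zw_act (n : int) : D -> D := comp_poly (waff n) \o map_poly (zscale n).
HB.instance Definition _ n := GRing.RMorphism.on (zw_act n).

Lemma zw_actC n p : zw_act n p%:P = (zscale n p)%:P.
Proof. by rewrite /zw_act /= map_polyC comp_polyC. Qed.

Lemma zw_actw n : zw_act n 'X = waff n.
Proof. by rewrite /zw_act /= map_polyX comp_polyX. Qed.

Lemma zscaleC n k : zscale n k%:P = k%:P.
Proof. by rewrite /zscale comp_polyC. Qed.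

Lemma zscalez n : zscale n 'X = q ^ (L * n) *: 'X.
Proof. by rewrite /zscale comp_polyX. Qed.

Lemma zscale0 p : zscale 0 p = p.
Proof. by rewrite /zscale mulr0 expr0z scale1r comp_polyXr. Qed.

Lemma zscaleD i j p : zscale (i + j) p = zscale i (zscale j p).
Proof.
rewrite /zscale -comp_polyA; congr (_ \Po _).
by rewrite comp_polyZ comp_polyX scalerA mulrDr expfzDr// mulrC.
Qed.

Lemma zw_act0 p : zw_act 0 p = p.
Proof.
rewrite /zw_act /= /waff mulr0 expr0z scale1r mulr0z !polyC0 addr0 comp_polyXr.
by apply: map_poly_id => c _; exact: zscale0.
Qed.

Lemma zw_actD i j p : zw_act (i + j) p = zw_act i (zw_act j p).
Proof.
rewrite /zw_act /= map_comp_poly -comp_polyA -map_poly_comp; congr (_ \Po _); last first.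
  by apply: eq_map_poly => c; rewrite /= zscaleD.
rewrite /waff rmorphD /= map_polyC map_polyZ map_polyX /= !zscaleC comp_polyD.
rewrite comp_polyZ comp_polyX comp_polyC scalerDr scalerA -polyCM -addrA.
rewrite mulrDr expfzDr// [q ^ (P * i) * _]mulrC; congr (_ + _).
rewrite mulrzDr !polyCD.
by case: P_or_nu => ->; rewrite ?mul0r ?mul0rz ?expr0z ?polyC0 ?scaler0 ?scale1r ?add0r.
Qed.

Definition zw_action : int_action D := IntAction zw_act0 zw_actD.
End AffineAction.

Section Degrees.
Variables (K : fieldType) (q : K) (L P : int) (nu : K).
Hypothesis q_neq0 : q != 0.
Hypothesis P_or_nu : P = 0 \/ nu = 0.
Local Notation D := {poly {poly K}}.
Local Notation tau := (zw_action L q_neq0 P_or_nu).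
Implicit Types (c d : D) (n : int).

Definition wdeg d : nat := (size d).-1.
Definition zdeg d : nat := (size (lead_coef d)).-1.
(** The coefficient at the largest monomial for the lexicographic order on
    exponents of w, then z; it is multiplicative. *)
Definition corner_coef d : K := lead_coef (lead_coef d).

Lemma wdegM c d : c != 0 -> d != 0 -> wdeg (c * d) = (wdeg c + wdeg d)%N.
Proof.
rewrite -!size_poly_gt0 /wdeg => c0 d0; rewrite size_mul -?size_poly_gt0//.
by case: (size c) (size d) c0 d0 => // m [|k]; rewrite ?addnS.
Qed.

Lemma zdegM c d : c != 0 -> d != 0 -> zdeg (c * d) = (zdeg c + zdeg d)%N.
Proof.
rewrite -lead_coef_eq0 -(lead_coef_eq0 d) /zdeg lead_coefM => c0 d0.
rewrite size_mul//; move: c0 d0; rewrite -!size_poly_gt0.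
by case: (size _) (size _) => // m [|k]; rewrite ?addnS.
Qed.

Lemma corner_coefM c d : corner_coef (c * d) = corner_coef c * corner_coef d.
Proof. by rewrite /corner_coef !lead_coefM. Qed.

Lemma corner_coef_eq0 d : (corner_coef d == 0) = (d == 0).
Proof. by rewrite !lead_coef_eq0. Qed.

Lemma poly_degree0 d : wdeg d = 0%N -> zdeg d = 0%N -> d = (corner_coef d)%:P%:P.
Proof.
rewrite /corner_coef /zdeg => wd zd.
rewrite {1}[d]size1_polyC; last first.
  by rewrite /wdeg in wd *; case: (size d) wd => // -[].
move: zd; rewrite /lead_coef -/(wdeg d) wd => zd; congr _%:P.
by rewrite {1}[d`_0]size1_polyC ?zd//; case: (size d`_0) zd => // -[].
Qed.

Lemma size_zscale n (p : {poly K}) : size (zscale q L n p) = size p.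
Proof.
by apply: size_comp_poly2; rewrite size_scale ?size_polyX// expfz_neq0.
Qed.

Lemma size_waff n : size (waff q P nu n) = 2.
Proof.
rewrite /waff size_polyDl ?size_scale ?size_polyX// ?polyC_eq0 ?expfz_neq0//.
by rewrite ltnS size_polyC_leq1.
Qed.

Lemma zscale_inj n : injective (zscale q L n).
Proof.
move=> c d /eqP; rewrite -subr_eq0 -rmorphB -size_poly_eq0 size_zscale.
by rewrite size_poly_eq0 subr_eq0 => /eqP.
Qed.

Lemma size_tau n d : size (tau n d) = size d.
Proof.
rewrite /= /zw_act /= size_comp_poly2 ?size_waff//.
by apply: size_map_inj_poly; [exact: zscale_inj|exact: rmorph0].
Qed.

Lemma lead_coef_tau n d : lead_coef (tau n d) =
  zscale q L n (lead_coef d) * (q ^ (P * n))%:P ^+ wdeg d.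
Proof.
rewrite /= /zw_act /= lead_coef_comp ?size_waff//.
rewrite (lead_coef_map_inj (@zscale_inj n)) ?rmorph0//; congr (_ * _ ^+ _).
  rewrite /waff lead_coefDl ?lead_coefZ ?lead_coefX ?mulr1//.
  rewrite size_scale ?size_polyX ?polyC_eq0 ?expfz_neq0//.
  by rewrite ltnS size_polyC_leq1.
by rewrite (size_map_inj_poly (@zscale_inj n)) ?rmorph0.
Qed.

Lemma wdeg_tau n d : wdeg (tau n d) = wdeg d.
Proof. by rewrite /wdeg size_tau. Qed.

Lemma zdeg_tau n d : zdeg (tau n d) = zdeg d.
Proof.
rewrite /zdeg lead_coef_tau -rmorphXn mulrC mul_polyC.
by rewrite size_scale ?size_zscale// expf_neq0// expfz_neq0.
Qed.

(** The automorphism multiplies every monomial by a power of q, up to terms of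
    lower degree in w. *)
Lemma corner_coef_tau n d : exists E : int, corner_coef (tau n d) = q ^ E * corner_coef d.
Proof.
exists (P * n * (wdeg d)%:Z + L * n * (zdeg d)%:Z).
rewrite /corner_coef lead_coef_tau -rmorphXn mulrC mul_polyC lead_coefZ.
rewrite lead_coef_comp ?size_scale ?size_polyX ?expfz_neq0//.
rewrite lead_coefZ lead_coefX mulr1 -/(zdeg d) !exprnP !exprz_exp.
by rewrite expfzDr// mulrCA mulrC.
Qed.
(** Two comparisons of leading coefficients determine d as an expression of the
    form A tau(B) / (B tau(A')), where A, A' have the same degrees.  So d has
    degree 0 in w and in z; it is a power of q because tau multiplies corner
    coefficients by powers of q, which makes those of A and A' differ by one. *)
Lemma cocycle_scalar (A B A' d : D) (i k : int) :
  A != 0 -> B != 0 -> A' != 0 -> d != 0 ->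
  A * tau i B = B * tau i A' -> A * tau k B = B * tau i d * tau k A' ->
  exists E : int, d = (q ^ E)%:P%:P.
Proof.
move=> A0 B0 A'0 d0 AB ABd.
have wd : wdeg d = 0%N.
  have := congr1 wdeg ABd; have := congr1 wdeg AB.
  rewrite !wdegM ?mulf_neq0 ?int_act_eq0// !wdeg_tau => ->.
  by move/eqP; rewrite addnAC -[X in X == _]addn0 eqn_add2l => /eqP.
have zd : zdeg d = 0%N.
  have := congr1 zdeg ABd; have := congr1 zdeg AB.
  rewrite !zdegM ?mulf_neq0 ?int_act_eq0// !zdeg_tau => ->.
  by move/eqP; rewrite addnAC -[X in X == _]addn0 eqn_add2l => /eqP.
suff [E dE] : exists E : int, corner_coef d = q ^ E.
  by exists E; rewrite {1}(poly_degree0 wd zd) dE.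
have := congr1 corner_coef ABd; have := congr1 corner_coef AB.
rewrite !corner_coefM.
have [e1 ->] := corner_coef_tau i B.
have [e2 ->] := corner_coef_tau i A'.
have [e3 ->] := corner_coef_tau k B.
have [e4 ->] := corner_coef_tau i d.
have [e5 ->] := corner_coef_tau k A'.
have : corner_coef A' != 0 by rewrite corner_coef_eq0.
have : corner_coef B != 0 by rewrite corner_coef_eq0.
move: (corner_coef A) (corner_coef B) (corner_coef A') (corner_coef d).
move=> cA cB cA' cd cB0 cA'0 AB' ABd'.
exists (e2 - e1 + e3 - e4 - e5).
rewrite !expfzDr// -!invr_expz.
have qe e : q ^ e != 0 by rewrite expfz_neq0.
have {}AB' : cA = q ^ e2 / q ^ e1 * cA'.
  apply: (mulIf (qe e1)); apply: (mulIf cB0).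
  rewrite [RHS](_ : _ = cB * (q ^ e2 * cA')); first by rewrite -AB'; ring.
  by field; exact: qe.
apply: (mulIf (qe e4)); apply: (mulIf (qe e5)); apply: (mulIf cA'0).
apply: (mulfI cB0).
rewrite [LHS](_ : _ = cB * (q ^ e4 * cd) * (q ^ e5 * cA')); last by ring.
rewrite -ABd' AB'; field.
by rewrite !qe.
Qed.
End Degrees.

(** * Conjugations of finite order are trivial *)

Section Embedding.
Variables (D : idomainType) (tau : int_action D) (R : nzRingType).
Local Notation T := (skew_laurent tau).
Variable iota : {rmorphism R -> T}.
Hypothesis iota_inj : injective iota.

Lemma iota_eq0 r : (iota r == 0) = (r == 0).
Proof. by rewrite -(rmorph0 iota) (inj_eq iota_inj). Qed.

Lemma embedded_domain (r s : R) : r * s = 0 -> r = 0 \/ s = 0.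
Proof.
move/(congr1 iota); rewrite rmorphM rmorph0 => /skew_laurent_domain.
by move=> [/eqP|/eqP]; rewrite iota_eq0 => /eqP; [left|right].
Qed.

Lemma embedded_mulf_neq0 (r s : R) : r != 0 -> s != 0 -> r * s != 0.
Proof. by move=> /eqP r0 /eqP s0; apply/eqP => /embedded_domain[]. Qed.

Section Conjugation.
Variables (g : R -> R) (a b : R).
Hypotheses (a_neq0 : a != 0) (b_neq0 : b != 0).
Hypothesis g1 : g 1 = 1.
Hypothesis g_conj : forall s, a * s * b = b * g s * g a.

Lemma conj_ab : a * b = b * g a.
Proof. by have := g_conj 1; rewrite g1 !mulr1. Qed.

Lemma conj_ga_neq0 : g a != 0.
Proof.
apply: contra_neq (embedded_mulf_neq0 a_neq0 b_neq0) => ga0.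
by rewrite conj_ab ga0 mulr0.
Qed.

Lemma conj_neq0 s : s != 0 -> g s != 0.
Proof.
move=> s0; have := embedded_mulf_neq0 (embedded_mulf_neq0 a_neq0 s0) b_neq0.
by apply: contra_neq => gs0; rewrite g_conj gs0 mulr0 mul0r.
Qed.

Lemma lead_exists_iota e s : s != 0 -> exists n, lead e (iota s) n.
Proof. by rewrite -iota_eq0; exact: lead_exists. Qed.

(** The top and bottom exponents are additive, and the relation for s = 1 gives
    those of g a; so g preserves both ends of every element. *)
Lemma lead_conj e s m : e != 0 -> lead e (iota s) m -> lead e (iota (g s)) m.
Proof.
move=> e0 s_m.
have s0 : s != 0.
  by rewrite -iota_eq0; apply: contraTneq s_m.1 => ->; rewrite mcoeff0 eqxx.
have [n gs_n] := lead_exists_iota e (conj_neq0 s0).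
have [i a_i] := lead_exists_iota e a_neq0.
have [j b_j] := lead_exists_iota e b_neq0.
have [k ga_k] := lead_exists_iota e conj_ga_neq0.
have ik : i = k.
  apply: (addIr j); rewrite [k + j]addrC.
  apply: (lead_uniq e0 (leadM e0 a_i b_j)).
  by rewrite -rmorphM conj_ab rmorphM; exact: leadM.
suff -> : m = n by [].
apply: (addrI (i + j)); rewrite addrAC.
apply: (lead_uniq e0 (leadM e0 (leadM e0 a_i s_m) b_j)).
rewrite -!rmorphM g_conj !rmorphM.
rewrite (_ : i + j + n = j + n + k); last by rewrite ik [k + j]addrC addrAC.
by apply: leadM => //; exact: leadM.
Qed.

Lemma conj_monomial s d m : d != 0 -> iota s = lau tau d m ->
  iota (g s) = lau tau (iota (g s))@_m m.
Proof.
move=> d0 s_d; apply: lead_two_sided; apply: lead_conj => //; rewrite s_d;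
  exact: lead_lau.
Qed.

(** The same exponents i and j and the same coefficients serve for all homogeneous
    s; this uniformity is what later ties the image of y to that of the degree 0
    part. *)
Lemma conj_coef : exists (i j : int) (A B A' : D), [/\ A != 0, B != 0, A' != 0,
  A * tau i B = B * tau j A' & forall s d m d', d != 0 ->
    iota s = lau tau d m -> iota (g s) = lau tau d' m ->
    A * tau i d * tau (i + m) B = B * tau j d' * tau (j + m) A'].
Proof.
have e0 : (1 : int) != 0 by [].
have [i a_i] := lead_exists_iota 1 a_neq0.
have [j b_j] := lead_exists_iota 1 b_neq0.
have ga_i := lead_conj e0 a_i.
exists i, j, (iota a)@_i, (iota b)@_j, (iota (g a))@_i; split.
- exact: a_i.1.
- exact: b_j.1.
- exact: ga_i.1.
- rewrite -(coef_leadM e0 a_i b_j) -(coef_leadM e0 b_j ga_i) addrC.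
  by rewrite -!rmorphM conj_ab.
move=> s d m d' d0 s_d gs_d'.
have s_m : lead 1 (iota s) m by rewrite s_d; exact: lead_lau.
have gs_m := lead_conj e0 s_m.
have := congr1 (fun r => (iota r)@_(i + m + j)) (g_conj s).
rewrite !rmorphM (coef_leadM e0 (leadM e0 a_i s_m) b_j).
rewrite (_ : i + m + j = j + m + i); last by rewrite addrC addrA addrAC.
rewrite (coef_leadM e0 (leadM e0 b_j gs_m) ga_i).
rewrite (coef_leadM e0 a_i s_m) (coef_leadM e0 b_j gs_m).
by rewrite s_d gs_d' !mcoeffUU.
Qed.

End Conjugation.
End Embedding.

Section Rigidity.
Variables (K : fieldType) (q : K) (L P : int) (nu : K).
Hypothesis q_neq0 : q != 0.
Hypothesis q_nroot1 : forall n : nat, (0 < n)%N -> q ^+ n != 1.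
Hypothesis P_or_nu : P = 0 \/ nu = 0.
Local Notation D := {poly {poly K}}.
Local Notation tau := (zw_action L q_neq0 P_or_nu).
Local Notation T := (skew_laurent tau).

Lemma q_expz_eq1 (n : int) : q ^ n = 1 -> n = 0.
Proof.
case: n => [[//|n]|n] /eqP; first by rewrite -exprnP (negPf (q_nroot1 _)).
by rewrite NegzE -exprnN invr_eq1 (negPf (q_nroot1 _)).
Qed.

Variables (R : algType K) (iota : {rmorphism R -> T}).
Hypothesis iota_inj : injective iota.
Hypothesis iota_scalar : forall k : K, iota k%:A = lau tau k%:P%:P 0.

Lemma embedded_scale k r d n : iota r = lau tau d n ->
  iota (k *: r) = lau tau (k%:P%:P * d) n.
Proof.
move=> r_d; rewrite -mulr_algl rmorphM iota_scalar r_d lauM add0r.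
by rewrite int_act0.
Qed.

Section Conjugation.
Variables (g : {rmorphism R -> R}) (N : nat) (a b : R).
Hypothesis N_gt0 : (0 < N)%N.
Hypothesis g_order : forall r, iter N g r = r.
Hypotheses (a_neq0 : a != 0) (b_neq0 : b != 0).
Hypothesis g_conj : forall s, a * s * b = b * g s * g a.

Lemma conj_power s k : g (k%:A) = k%:A -> g s = k *: s -> s != 0 -> k ^+ N = 1.
Proof.
move=> gk gs s0.
have iterg n : iter n g s = k ^+ n *: s.
  elim: n => [|n IHn]; first by rewrite scale1r.
  have gkn : g (k ^+ n)%:A = (k ^+ n)%:A.
    by rewrite -[(k ^+ n)%:A]/(in_alg R (k ^+ n)) rmorphXn rmorphXn /= gk.
  by rewrite iterS IHn -mulr_algl rmorphM gkn gs mulr_algl scalerA -exprSr.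
have := iterg N; rewrite g_order => /esym/eqP.
rewrite -{2}[s]scale1r -subr_eq0 -scalerBl scaler_eq0 (negPf s0) orbF.
by rewrite subr_eq0 => /eqP.
Qed.

Variables (s1 y : R) (d1 : D) (E1 : int).
Hypotheses (d1_neq0 : d1 != 0) (E1_neq0 : E1 != 0).
Hypothesis s1_d1 : iota s1 = lau tau d1 0.
Hypothesis d1_weight : forall n, tau n d1 = (q ^ (E1 * n))%:P%:P * d1.
Hypothesis iota_y : iota y = lau tau 1 1.

Lemma q_power_root (E : int) : (q ^ E) ^+ N = 1 -> E = 0.
Proof.
rewrite exprnP exprz_exp => /q_expz_eq1/eqP; rewrite mulf_eq0 => /orP[/eqP//|].
by case: N N_gt0.
Qed.

(** On the degree 0 part, g acts as tau^n, where n is the difference of the top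
    exponents of a and b: the coefficients of a and b cancel, as they do already
    for s = 1.  The eigenvector d1 has eigenvalue q^(E1 n), which finite order
    forces to be 1, so n = 0.  Then g y = d y for a cocycle d as in
    cocycle_scalar, and finite order gives d = 1. *)
Lemma conj_fixes : g y = y /\ forall s d, iota s = lau tau d 0 -> g s = s.
Proof.
have [i [j [A [B [A' [A0 B0 A'0 AB main]]]]]] :=
  conj_coef iota_inj a_neq0 b_neq0 (rmorph1 g) g_conj.
have monomial := conj_monomial iota_inj a_neq0 b_neq0 (rmorph1 g) g_conj.
have iota0 := iota_eq0 iota_inj.
have degree0 s d : iota s = lau tau d 0 ->
    iota (g s) = lau tau (tau (- j + i) d) 0.
  move=> s_d; have [d0|d0] := eqVneq d 0.
    have -> : s = 0 by apply/eqP; rewrite -iota0 s_d d0 /lau monalgU0.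
    by rewrite d0 !rmorph0 /lau monalgU0.
  have gs := monomial _ _ _ d0 s_d; rewrite gs; congr lau.
  set d' := (iota (g s))@_0 in gs *; have := main s d 0 d' d0 s_d gs.
  rewrite !addr0 mulrAC AB [RHS]mulrAC => /mulfI dd'.
  by rewrite int_actD dd' ?mulf_neq0 ?int_act_eq0// -int_actD addNr int_act0.
have g_scalar k : g k%:A = k%:A.
  apply: iota_inj; rewrite iota_scalar (degree0 _ _ (iota_scalar k)); congr lau.
  by rewrite /= zw_actC zscaleC.
have n0 : - j + i = 0.
  have gs1 : g s1 = q ^ (E1 * (- j + i)) *: s1.
    by apply: iota_inj; rewrite (degree0 _ _ s1_d1) d1_weight (embedded_scale _ s1_d1).
  have s1_neq0 : s1 != 0 by rewrite -iota0 s1_d1 monalgU_eq0.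
  have /q_power_root/eqP := conj_power (g_scalar _) gs1 s1_neq0.
  by rewrite mulf_eq0 (negPf E1_neq0) => /eqP.
have ij : i = j by apply/eqP; rewrite -subr_eq0 addrC n0.
split=> [|s d s_d]; last first.
  by apply: iota_inj; rewrite (degree0 _ _ s_d) n0 int_act0 s_d.
have y_neq0 : y != 0 by rewrite -iota0 iota_y monalgU_eq0 oner_eq0.
have gy := monomial _ _ _ (oner_neq0 _) iota_y.
set d' := (iota (g y))@_1 in gy.
have d'0 : d' != 0.
  have := conj_neq0 iota_inj a_neq0 b_neq0 g_conj y_neq0.
  by rewrite -iota0 gy monalgU_eq0.
have := main y 1 1 d' (oner_neq0 _) iota_y gy.
rewrite rmorph1 mulr1 -{}ij in AB * => ABd'.
have [E d'E] := cocycle_scalar A0 B0 A'0 d'0 AB ABd'.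
have gyE : g y = q ^ E *: y.
  apply: iota_inj; rewrite gy (embedded_scale _ iota_y) mulr1; congr lau.
  exact: d'E.
have /q_power_root E0 := conj_power (g_scalar _) gyE y_neq0.
by rewrite gyE E0 expr0z scale1r.
Qed.
End Conjugation.
End Rigidity.

(** * Spanning by ordered monomials and injectivity *)

Section FamilySpan.
Variables (A V : zmodType) (inA : A -> Prop) (f : nat -> A -> V).
Hypothesis inA0 : inA 0.
Hypothesis inAD : forall a b, inA a -> inA b -> inA (a + b).
Hypothesis fD : forall k, {morph f k : a b / a + b}.

(** The span of the sets f k A, for instance of A y^k when f k is right
    multiplication by y^k. *)
Definition family_span (v : V) : Prop := exists (n : nat) (m : nat -> A),
  (forall k, inA (m k)) /\ v = \sum_(k < n) f k (m k).

Lemma fam0 k : f k 0 = 0.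
Proof. by apply: (addrI (f k 0)); rewrite -fD !addr0. Qed.

Lemma family_span0 : family_span 0.
Proof. by exists 0%N, (fun=> 0); rewrite big_ord0. Qed.

Lemma family_span_mem k a : inA a -> family_span (f k a).
Proof.
move=> Aa; exists k.+1, (fun i => if i == k then a else 0); split=> [i|].
  by case: eqP.
rewrite (bigD1 ord_max)//= eqxx big1 ?addr0// => i.
by rewrite -val_eqE /= => /negPf->; exact: fam0.
Qed.

Lemma family_spanD u v : family_span u -> family_span v -> family_span (u + v).
Proof.
move=> [n [m [Am ->]]] [n' [m' [Am' ->]]].
have widen N k (l : nat -> A) : (k <= N)%N ->
    \sum_(i < k) f i (l i) = \sum_(i < N) f i (if (i < k)%N then l i else 0).
  move=> kN; rewrite (big_ord_widen N (fun i => f i (l i)) kN) big_mkcond.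
  by apply: eq_bigr => i _; case: ifP => // _; rewrite fam0.
rewrite (widen (maxn n n')) ?leq_maxl// (widen (maxn n n') n') ?leq_maxr//.
rewrite -big_split /=; exists (maxn n n'), (fun i =>
  (if (i < n)%N then m i else 0) + (if (i < n')%N then m' i else 0)).
split=> [k|]; last by apply: eq_bigr => i _; rewrite fD.
by apply: inAD; case: ifP.
Qed.

Lemma family_span_ind (W : V -> Prop) : W 0 ->
  (forall u v, W u -> W v -> W (u + v)) ->
  (forall k a, inA a -> W (f k a)) -> forall v, family_span v -> W v.
Proof.
move=> W0 WD Wf _ [n [m [Am ->]]]; elim/big_ind: _ => // i _; exact: Wf.
Qed.

(** Triangularity: the last term of a vanishing sum can be removed, hence all of
    them. *)
Lemma family_span_kernel (W : zmodType) (iota : {additive V -> W}) :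
  (forall n (m : nat -> A), (forall k, inA (m k)) ->
     iota (\sum_(k < n.+1) f k (m k)) = 0 -> f n (m n) = 0) ->
  forall v, family_span v -> iota v = 0 -> v = 0.
Proof.
move=> top _ [n [m [Am ->]]]; elim: n => [|n IHn]; first by rewrite big_ord0.
by move=> s0; move: (s0); rewrite big_ord_recr /= (top _ _ Am s0) addr0.
Qed.
End FamilySpan.

Section Spanning.
Variables (K : fieldType) (R : algType K) (x y z s : R) (a b c : K).
Hypothesis xy : x * y = a *: (y * x) + s.
Hypothesis xz : x * z = b *: (z * x).
Hypothesis zy : z * y = c *: (y * z).
Hypothesis s_yz : s \in [:: 0; 1; y; z].

Local Notation ev := (horner_alg z).

(** The span of the y^i z^j, with the powers of z gathered into a polynomial: when
    z = 1 these products are not independent. *)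
Definition yz_span : R -> Prop :=
  family_span (fun=> True) (fun i (p : {poly K}) => y ^+ i * ev p).

Definition yzx_span : R -> Prop :=
  family_span yz_span (fun k r => r * x ^+ k).

Lemma yz_famD i : {morph (fun p : {poly K} => y ^+ i * ev p) : p r / p + r}.
Proof. by move=> p r; rewrite rmorphD mulrDr. Qed.

Lemma yzx_famD k : {morph (fun r : R => r * x ^+ k) : r t / r + t}.
Proof. by move=> r t; rewrite mulrDl. Qed.

Lemma yz_span0 : yz_span 0. Proof. by apply: family_span0. Qed.

Lemma yz_spanD u v : yz_span u -> yz_span v -> yz_span (u + v).
Proof. by apply: family_spanD => // i; exact: yz_famD. Qed.

Lemma yz_span_mem i p : yz_span (y ^+ i * ev p).
Proof. by apply: family_span_mem => // k; exact: yz_famD. Qed.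

Lemma yz_span1 : yz_span 1.
Proof. by have := yz_span_mem 0 1; rewrite rmorph1 mulr1. Qed.

Lemma yz_spanZ k u : yz_span u -> yz_span (k *: u).
Proof.
apply: (family_span_ind (W := fun v => yz_span (k *: v))) =>
  [|v w|i p _]; first by rewrite scaler0; exact: yz_span0.
  by rewrite scalerDr; exact: yz_spanD.
have -> : k *: (y ^+ i * ev p) = y ^+ i * ev (k *: p).
  by rewrite scalerAr -[in RHS]mul_polyC rmorphM /= horner_algC mulr_algl.
exact: yz_span_mem.
Qed.

Lemma yz_span_mulz u : yz_span u -> yz_span (z * u).
Proof.
apply: (family_span_ind (W := fun v => yz_span (z * v))) =>
  [|v w|i p _]; first by rewrite mulr0; exact: yz_span0.
  by rewrite mulrDr; exact: yz_spanD.
have -> : z * (y ^+ i * ev p) = c ^+ i *: (y ^+ i * ev ('X * p)).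
  rewrite rmorphM /= horner_algX mulrA mulrA scalerAl; congr (_ * _).
  elim: i => [|i IHi]; first by rewrite expr0 mulr1 mul1r scale1r.
  rewrite exprSr mulrA IHi -scalerAl -[_ * z * y]mulrA zy -scalerAr scalerA.
  by rewrite mulrA [c ^+ _.+1]exprSr.
exact/yz_spanZ/yz_span_mem.
Qed.

Lemma yz_span_muly u : yz_span u -> yz_span (y * u).
Proof.
apply: (family_span_ind (W := fun v => yz_span (y * v))) =>
  [|v w|i p _]; first by rewrite mulr0; exact: yz_span0.
  by rewrite mulrDr; exact: yz_spanD.
by rewrite mulrA -exprS; exact: yz_span_mem.
Qed.

Lemma yz_span_muls u : yz_span u -> yz_span (s * u).
Proof.
move=> u_yz; move: s_yz; rewrite !inE => /or4P[]/eqP->.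
- by rewrite mul0r; exact: yz_span0.
- by rewrite mul1r.
- exact: yz_span_muly.
- exact: yz_span_mulz.
Qed.

Lemma yz_span_min (W : R -> Prop) : W 1 ->
  (forall u v, W u -> W v -> W (u + v)) -> (forall k u, W u -> W (k *: u)) ->
  (forall u, yz_span u -> W u -> W (y * u)) ->
  (forall u, yz_span u -> W u -> W (z * u)) ->
  forall u, yz_span u -> W u.
Proof.
move=> W1 WD WZ Wy Wz.
have W0 : W 0 by rewrite -(scale0r 1); exact: WZ.
apply: (family_span_ind (W := fun v => W v)) => // i p _.
elim: i => [|i IHi]; last by rewrite exprS -mulrA; apply: Wy => //; exact: yz_span_mem.
rewrite mul1r; elim/poly_ind: p => [|p k IHp]; first by rewrite rmorph0.
rewrite mulrC rmorphD rmorphM /= horner_algX horner_algC; apply: WD; last exact: WZ.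
by apply: Wz => //; have := yz_span_mem 0 p; rewrite mul1r.
Qed.

(** Moving x to the right across y^i z^j costs only terms free of x. *)
Lemma yz_span_mulx u : yz_span u -> exists v w,
  [/\ yz_span v, yz_span w & x * u = v * x + w].
Proof.
apply: (yz_span_min (W := fun u => exists v w,
  [/\ yz_span v, yz_span w & x * u = v * x + w])) =>
  [|t u' [v [w [v_yz w_yz tE]]] [v' [w' [v'_yz w'_yz u'E]]]
  |k t [v [w [v_yz w_yz tE]]]|t t_yz [v [w [v_yz w_yz tE]]]
  |t t_yz [v [w [v_yz w_yz tE]]]].
- exists 1, 0; rewrite mulr1 mul1r addr0; split=> //; [exact: yz_span1|exact: yz_span0].
- exists (v + v'), (w + w'); split; [exact: yz_spanD|exact: yz_spanD|].
  by rewrite mulrDr mulrDl tE u'E addrACA.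
- exists (k *: v), (k *: w); split; [exact: yz_spanZ|exact: yz_spanZ|].
  by rewrite -scalerAr tE scalerDr scalerAl.
- exists (a *: (y * v)), (a *: (y * w) + s * t); split.
  + exact/yz_spanZ/yz_span_muly.
  + apply: yz_spanD; last exact: yz_span_muls.
    exact/yz_spanZ/yz_span_muly.
  rewrite mulrA xy mulrDl -scalerAl -mulrA tE mulrDr scalerDr addrA mulrA.
  by rewrite scalerAl.
- exists (b *: (z * v)), (b *: (z * w)); split.
  + exact/yz_spanZ/yz_span_mulz.
  + exact/yz_spanZ/yz_span_mulz.
  by rewrite mulrA xz -scalerAl -mulrA tE mulrDr scalerDr mulrA scalerAl.
Qed.

Lemma yzx_spanD u v : yzx_span u -> yzx_span v -> yzx_span (u + v).
Proof. by apply: family_spanD; [exact: yz_span0|exact: yz_spanD|exact: yzx_famD]. Qed.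

Lemma yzx_span0 : yzx_span 0.
Proof. by apply: family_span0; exact: yz_span0. Qed.

Lemma yzx_span_mem k u : yz_span u -> yzx_span (u * x ^+ k).
Proof. by apply: family_span_mem => [|i]; [exact: yz_span0|exact: yzx_famD]. Qed.

Lemma yzx_span1 : yzx_span 1.
Proof. by have := yzx_span_mem 0 yz_span1; rewrite mulr1. Qed.

Lemma yzx_span_lin (h : R -> R) : {morph h : u v / u + v} ->
  (forall u v, h (u * v) = h u * v) ->
  (forall u, yz_span u -> yz_span (h u)) -> forall u, yzx_span u -> yzx_span (h u).
Proof.
move=> hD hM h_yz u; apply: (family_span_ind (W := fun v => yzx_span (h v))) =>
  [|v w|k v v_yz].
- by rewrite -(mul0r 0) hM mulr0; exact: yzx_span0.
- by rewrite hD; exact: yzx_spanD.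
- by rewrite hM; exact/yzx_span_mem/h_yz.
Qed.

Lemma yzx_spanZ k u : yzx_span u -> yzx_span (k *: u).
Proof.
apply: yzx_span_lin => [v w|v w|v]; [exact: scalerDr|exact: scalerAl|exact: yz_spanZ].
Qed.

Lemma yzx_span_muly u : yzx_span u -> yzx_span (y * u).
Proof.
apply: yzx_span_lin => [v w|v w|v]; [exact: mulrDr|exact: mulrA|exact: yz_span_muly].
Qed.

Lemma yzx_span_mulz u : yzx_span u -> yzx_span (z * u).
Proof.
apply: yzx_span_lin => [v w|v w|v]; [exact: mulrDr|exact: mulrA|exact: yz_span_mulz].
Qed.

Lemma yzx_span_mulx u : yzx_span u -> yzx_span (x * u).
Proof.
apply: (family_span_ind (W := fun v => yzx_span (x * v))) =>
  [|v w|k v v_yz]; first by rewrite mulr0; exact: yzx_span0.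
  by rewrite mulrDr; exact: yzx_spanD.
have [v' [w [v'_yz w_yz vE]]] := yz_span_mulx v_yz.
rewrite mulrA vE mulrDl -mulrA -exprS; apply: yzx_spanD; exact: yzx_span_mem.
Qed.

Hypothesis generated : forall W : R -> Prop, W 1 ->
  (forall u v, W u -> W v -> W (u + v)) -> (forall k u, W u -> W (k *: u)) ->
  (forall u, W u -> W (x * u)) -> (forall u, W u -> W (y * u)) ->
  (forall u, W u -> W (z * u)) -> forall u, W u.

Lemma yzx_spanT u : yzx_span u.
Proof.
apply: generated u; [exact: yzx_span1|exact: yzx_spanD|exact: yzx_spanZ
  |exact: yzx_span_mulx|exact: yzx_span_muly|exact: yzx_span_mulz].
Qed.
End Spanning.

Section Injectivity.
Variables (K : fieldType) (q : K) (L P : int) (nu : K).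
Hypothesis q_neq0 : q != 0.
Hypothesis P_or_nu : P = 0 \/ nu = 0.
Local Notation D := {poly {poly K}}.
Local Notation tau := (zw_action L q_neq0 P_or_nu).
Local Notation T := (skew_laurent tau).

Variables (R : algType K) (iota : {rmorphism R -> T}) (x y z : R).
Hypothesis iota_scalar : forall k : K, iota k%:A = lau tau k%:P%:P 0.
Variables (zeta : {poly K}) (xi : D) (m : int).
Hypothesis iota_y : iota y = lau tau 1 1.
Hypothesis iota_z : iota z = lau tau zeta%:P 0.
(* When there is no generator z, both z and zeta are 1. *)
Hypothesis zeta_faithful : forall p, p \Po zeta = 0 -> horner_alg z p = 0.
Hypothesis iota_x : iota x = lau tau xi m.
Hypothesis xi_linear : size xi = 2.

Lemma iota_horner p : iota (horner_alg z p) = lau tau (p \Po zeta)%:P 0.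
Proof.
elim/poly_ind: p => [|p k IHp].
  by rewrite comp_poly0 !rmorph0 /lau monalgU0.
rewrite comp_polyD comp_polyM comp_polyX comp_polyC.
rewrite !rmorphD !rmorphM /= horner_algX horner_algC iota_scalar IHp iota_z.
by rewrite lauM addr0 int_act0 lauD.
Qed.

Lemma iota_expy i : iota (y ^+ i) = lau tau 1 i%:Z.
Proof.
elim: i => [|i IHi].
  by rewrite expr0; exact: (rmorph1 iota).
by rewrite exprSr rmorphM IHi iota_y lauM rmorph1 mulr1 -addn1.
Qed.

(** The powers of x have exactly increasing degree in w, which separates them
    from each other and from y and z. *)
Lemma iota_expx k : exists2 d, iota (x ^+ k) = lau tau d (m * k%:Z) & size d = k.+1.
Proof.
elim: k => [|k [d dk size_d]].
  exists 1; last exact: size_poly1.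
  by rewrite expr0 mulr0; exact: (rmorph1 iota).
exists (d * tau (m * k%:Z) xi).
  by rewrite exprSr rmorphM dk iota_x lauM -addn1 PoszD mulrDr mulr1.
have [d0 xi0] : d != 0 /\ xi != 0 by rewrite -!size_poly_gt0 size_d xi_linear.
by rewrite size_mul ?int_act_eq0// size_tau size_d xi_linear addn2.
Qed.

Lemma iota_yz_term i p :
  iota (y ^+ i * horner_alg z p) = lau tau (tau i%:Z (p \Po zeta)%:P) i%:Z.
Proof. by rewrite rmorphM iota_expy iota_horner lauM mul1r addr0. Qed.

Lemma iota_yz_inj u : yz_span y z u -> iota u = 0 -> u = 0.
Proof.
apply: family_span_kernel => n p _ /(congr1 (mcoeff n%:Z)).
rewrite big_ord_recr /= rmorphD rmorph_sum mcoeffD raddf_sum mcoeff0 big1 => [|i _].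
  rewrite add0r iota_yz_term coef_lau eqxx => /eqP; rewrite int_act_eq0 polyC_eq0.
  by move=> /eqP/zeta_faithful->; rewrite mulr0.
rewrite /= iota_yz_term coef_lau eqz_nat.
by case: eqP (ltn_ord i) => // ->; rewrite ltnn.
Qed.

Lemma iota_yz_size u j : yz_span y z u -> (size (iota u)@_j <= 1)%N.
Proof.
apply: (family_span_ind (W := fun u => (size (iota u)@_j <= 1)%N)).
- by rewrite rmorph0 mcoeff0 size_poly0.
- move=> v w; rewrite rmorphD mcoeffD => v1 w1.
  by apply: leq_trans (size_polyD _ _) _; rewrite geq_max v1.
move=> i p _; rewrite iota_yz_term coef_lau; case: eqP => _.
  by rewrite mulr1n size_tau size_polyC_leq1.
by rewrite size_poly0.
Qed.

(** The top coefficient in w of the image of a sum of v_k x^k, for v_k in the span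
    of the y^i z^j, comes from the last term only, which must therefore vanish. *)
Lemma iota_yzx_inj u : yzx_span x y z u -> iota u = 0 -> u = 0.
Proof.
apply: family_span_kernel => n v v_yz s0.
suff vn0 : iota (v n) = 0 by rewrite (iota_yz_inj (v_yz n) vn0) mul0r.
apply/malgP => j; rewrite mcoeff0; apply/eqP; apply: contraT => vnj.
have term k i : exists2 d, (iota (v k * x ^+ k))@_(i + m * k%:Z) =
    (iota (v k))@_i * d & size d = k.+1.
  have [d dk size_d] := iota_expx k.
  exists (tau i d); last by rewrite size_tau.
  by rewrite rmorphM dk coef_lau_mulr.
have [d dn size_d] := term n j.
have := congr1 (mcoeff (j + m * n%:Z)) s0.
rewrite big_ord_recr /= rmorphD mcoeffD mcoeff0 dn => /eqP; rewrite addr_eq0.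
move=> /eqP/(congr1 (fun d : D => size d)); rewrite size_polyN => sizeE.
have d0 : d != 0 by rewrite -size_poly_gt0 size_d.
have: (size ((iota (v n))@_j * d)%R <= n)%N.
  rewrite -sizeE rmorph_sum raddf_sum; apply: leq_trans (size_sum _ _ _) _.
  apply/bigmax_leqP => k _. rewrite /=.
  have [e] := term k (j + m * n%:Z - m * k%:Z); rewrite subrK => -> size_e.
  apply: leq_trans (size_polyMleq _ _) _.
  rewrite size_e addnS /= (leq_trans _ (ltn_ord k))// -add1n leq_add2r.
  exact: iota_yz_size.
rewrite size_mul// size_d addnS /= -[X in (_ <= X)%N]add0n leq_add2r leqn0.
by rewrite size_poly_eq0 (negPf vnj).
Qed.
End Injectivity.

(** * A criterion for primeness *)

Section PresentedModel.
Variables (K : fieldType) (D : idomainType) (tau : int_action D).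
Variable c : {rmorphism K -> D}.
Hypothesis c_fixed : forall k n, tau n (c k) = c k.
Local Notation T := (skew_laurent tau).

Lemma presented_model (n : nat) (rels : seq (free_alg K n)) (R : algType K)
    (f : {lrmorphism free_alg K n -> R}) (v : 'I_n -> T) :
  (forall r : R, exists u, f u = r) ->
  (forall u, f u = 0 <-> in_ideal rels u) ->
  (forall phi : {rmorphism free_alg K n -> T},
     (forall i, phi (gen K i) = v i) ->
     (forall k u, phi (k *: u) = lau_const tau (c k) * phi u) ->
     forall r, r \in rels -> phi r = 0) ->
  exists iota : {rmorphism R -> T}, (forall i, iota (f (gen K i)) = v i) /\
    forall k, iota k%:A = lau tau (c k) 0.
Proof.
move=> f_surj f_ker v_rels.
have [phi [phi_gen phi_scale]] := free_alg_lift (c := lau_const tau \o c) (v := v)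
  (fun k i => lau_const_central (v i) (c_fixed k) (mulrC (c k))).
have [iota iotaE] := presented_lift f_surj f_ker (v_rels _ phi_gen phi_scale).
exists iota; split=> [i|k]; first by rewrite iotaE.
by rewrite -(rmorph1 f) -linearZ iotaE phi_scale rmorph1 mulr1.
Qed.

End PresentedModel.

Section Criterion.
Variables (K : fieldType) (q : K) (L P : int) (nu : K).
Hypothesis q_neq0 : q != 0.
Hypothesis q_nroot1 : forall n : nat, (0 < n)%N -> q ^+ n != 1.
Hypothesis P_or_nu : P = 0 \/ nu = 0.
Local Notation D := {poly {poly K}}.
Local Notation tau := (zw_action L q_neq0 P_or_nu).
Local Notation T := (skew_laurent tau).

(** The common form of all the algebras: x becomes xi y^-e with xi of degree 1 in
    w, and s1 is a degree 0 element on which tau acts with infinite order.  An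
    automorphism g conjugating as above fixes y and, being of degree 0, y^e x;
    cancelling y^e, it fixes x. *)
Lemma prime_criterion (R : algType K) (x y z s : R) (a b c : K)
    (iota : {rmorphism R -> T}) (zeta : {poly K}) (xi : D) (e : nat)
    (s1 : R) (d1 : D) (E1 : int) :
  x * y = a *: (y * x) + s -> x * z = b *: (z * x) -> z * y = c *: (y * z) ->
  s \in [:: 0; 1; y; z] ->
  (forall W : R -> Prop, W 1 ->
    (forall u v, W u -> W v -> W (u + v)) -> (forall k u, W u -> W (k *: u)) ->
    (forall u, W u -> W (x * u)) -> (forall u, W u -> W (y * u)) ->
    (forall u, W u -> W (z * u)) -> forall u, W u) ->
  (forall k : K, iota k%:A = lau tau k%:P%:P 0) ->
  iota y = lau tau 1 1 -> iota z = lau tau zeta%:P 0 ->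
  (forall p, p \Po zeta = 0 -> horner_alg z p = 0) ->
  iota x = lau tau xi (- e%:Z) -> size xi = 2 ->
  d1 != 0 -> E1 != 0 -> iota s1 = lau tau d1 0 ->
  (forall n, tau n d1 = (q ^ (E1 * n))%:P%:P * d1) ->
  forall (gT : finGroupType) (act : gT -> {rmorphism R -> R})
    (t : gT -> gT -> R) (S : lalgType R) (bar : gT -> S),
  automorphism_group act -> crossed_product act t bar -> prime_ring S.
Proof.
move=> xy xz zy s_yz gen_R iota_c iota_y iota_z zeta_f iota_x xi2 d1_0 E1_0 s1_d1 d1_w.
move=> gT act t S bar actG S_cross.
have iota_inj : injective iota.
  move=> u v uv; apply/eqP; rewrite -subr_eq0; apply/eqP.
  apply: (iota_yzx_inj iota_c iota_y iota_z zeta_f iota_x xi2).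
    exact: (yzx_spanT xy xz zy s_yz gen_R).
  by rewrite rmorphB uv subrr.
have R_domain := embedded_domain iota_inj.
apply: (crossed_product_prime actG S_cross R_domain) => g r r' r0 r'0 g_conj.
have g_order u : iter #[g]%g (act g) u = u.
  suff -> n : iter n (act g) u = act (g ^+ n)%g u by rewrite expg_order (act_one actG).
  elim: n => [|n IHn]; first by rewrite expg0 (act_one actG).
  by rewrite iterS IHn -(act_mul actG) -expgS.
have [gy g0] := conj_fixes q_nroot1 iota_inj iota_c (order_gt0 g) g_order r0 r'0
  g_conj d1_0 E1_0 s1_d1 d1_w iota_y.
have gx : act g x = x.
  have ye_x : iota (y ^+ e * x) = lau tau (tau e%:Z xi) 0.
    by rewrite rmorphM (iota_expy iota_y) iota_x lauM mul1r subrr.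
  have := g0 _ _ ye_x; rewrite rmorphM rmorphXn gy => /eqP.
  rewrite -subr_eq0 -mulrBr => /eqP/R_domain[] /eqP; last by rewrite subr_eq0 => /eqP.
  rewrite -(iota_eq0 iota_inj) (iota_expy iota_y) monalgU_eq0.
  by rewrite oner_eq0.
apply: (act_faithful actG) => u; rewrite (act_one actG); move: u.
apply: gen_R => [|u v gu gv|k u gu|u gu|u gu|u gu].
- exact: rmorph1.
- by rewrite rmorphD gu gv.
- by rewrite -mulr_algl rmorphM gu (g0 _ _ (iota_c k)).
- by rewrite rmorphM gu gx.
- by rewrite rmorphM gu gy.
- by rewrite rmorphM gu (g0 _ _ iota_z).
Qed.
End Criterion.

(** * The five algebras *)

Lemma lau_skew_commutator (D : idomainType) (tau : int_action D) (k d d' : D)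
    (i j : int) :
  lau tau d i * lau tau d' j - lau_const tau k * (lau tau d' j * lau tau d i) =
  lau tau (d * tau i d' - k * (d' * tau j d)) (i + j).
Proof. by rewrite [lau _ _ j * _]lauM lau_constM lauM [j + i]addrC -lauB. Qed.

Lemma mem_triple (A : eqType) (a b c : A) :
  [/\ a \in [:: a; b; c], b \in [:: a; b; c] & c \in [:: a; b; c]].
Proof. by rewrite !inE !eqxx ?orbT. Qed.

Section CommutatorImages.
Variables (K : fieldType) (A : lalgType K).

Lemma lrmorph_commutator (R : algType K) (f : {lrmorphism A -> R}) a u v w :
  f (u * v - a *: (v * u) - w) = 0 ->
  f u * f v = a *: (f v * f u) + f w.
Proof.
rewrite !rmorphB /= linearZ !rmorphM => /eqP.
by rewrite subr_eq0 subr_eq addrC => /eqP.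
Qed.

Lemma lrmorph_commutator0 (R : algType K) (f : {lrmorphism A -> R}) a u v :
  f (u * v - a *: (v * u)) = 0 -> f u * f v = a *: (f v * f u).
Proof.
by move=> uv; rewrite (@lrmorph_commutator R f a u v 0) ?subr0// rmorph0 addr0.
Qed.

Lemma rmorph_commutator (T : nzRingType) (phi : {rmorphism A -> T}) (c : K -> T) :
  (forall k u, phi (k *: u) = c k * phi u) -> forall a u v,
  phi (u * v - a *: (v * u)) = phi u * phi v - c a * (phi v * phi u).
Proof. by move=> phiZ a u v; rewrite rmorphB phiZ !rmorphM. Qed.
End CommutatorImages.

Section Cases.
Variables (K : fieldType) (q : K).
Hypothesis q_neq0 : q != 0.
Hypothesis q_nroot1 : forall n : nat, (0 < n)%N -> q ^+ n != 1.
Local Notation D := {poly {poly K}}.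

Section ActionValues.
Variables (L P : int) (nu : K).
Hypothesis P_or_nu : P = 0 \/ nu = 0.
Local Notation tau := (zw_action L q_neq0 P_or_nu).

Lemma tau_w n : tau n 'X = (q ^ (P * n))%:P%:P * 'X + (nu *~ n)%:P%:P.
Proof. by rewrite /= zw_actw /waff mul_polyC. Qed.

Lemma tau_z n : tau n 'X%:P = (q ^ (L * n))%:P%:P * 'X%:P.
Proof. by rewrite /= zw_actC zscalez -polyCM mul_polyC. Qed.

Lemma tau_c k n : tau n (polyC (polyC k)) = polyC (polyC k).
Proof. by rewrite /= zw_actC zscaleC. Qed.
End ActionValues.

Lemma z_neq0 : 'X%:P != 0 :> D.
Proof. by rewrite polyC_eq0 polyX_eq0. Qed.

Lemma z_faithful (R : algType K) (z : R) (p : {poly K}) :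
  p \Po 'X = 0 -> horner_alg z p = 0.
Proof. by rewrite comp_polyXr => ->; rewrite rmorph0. Qed.

Section ThreeGenerators.
Variables (rels : seq (free_alg K 3)) (R : algType K).
Variable f : {lrmorphism free_alg K 3 -> R}.
Hypothesis f_surj : forall r : R, exists u, f u = r.
Hypothesis f_ker : forall u, f u = 0 <-> in_ideal rels u.

Local Notation gx := (gen K (@Ordinal 3 0 isT)).
Local Notation gy := (gen K (@Ordinal 3 1 isT)).
Local Notation gz := (gen K (@Ordinal 3 2 isT)).

Lemma ord3_ind (Q : 'I_3 -> Prop) : Q (@Ordinal 3 0 isT) ->
  Q (@Ordinal 3 1 isT) -> Q (@Ordinal 3 2 isT) -> forall i, Q i.
Proof.
move=> Q0 Q1 Q2 [[|[|[|//]]] Hi].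
- by rewrite (_ : Ordinal Hi = @Ordinal 3 0 isT)//; apply: val_inj.
- by rewrite (_ : Ordinal Hi = @Ordinal 3 1 isT)//; apply: val_inj.
- by rewrite (_ : Ordinal Hi = @Ordinal 3 2 isT)//; apply: val_inj.
Qed.

Lemma three_generated (W : R -> Prop) : W 1 ->
  (forall u v, W u -> W v -> W (u + v)) -> (forall k u, W u -> W (k *: u)) ->
  (forall u, W u -> W (f gx * u)) -> (forall u, W u -> W (f gy * u)) ->
  (forall u, W u -> W (f gz * u)) -> forall u, W u.
Proof.
move=> W1 WD WZ Wx Wy Wz; apply: (presented_gen_ind f_surj) => //.
exact: ord3_ind.
Qed.

(** The algebras in which y and z commute up to a power q^L with L <> 0; here z is
    the element on which tau acts with infinite order.  The relation between x and
    y becomes the displayed equation on xi, since x y = xi y^(1 - e). *)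
Lemma three_generator_prime (a : K) (s : free_alg K 3) (sigma : D)
    (L P : int) (nu : K) (P_or_nu : P = 0 \/ nu = 0) (e : nat) (xi : D) :
  let tau := zw_action L q_neq0 P_or_nu in
  L != 0 ->
  rels = [:: gx * gy - a *: (gy * gx) - s;
             gx * gz - q ^ (L * - e%:Z) *: (gz * gx);
             gy * gz - q ^ L *: (gz * gy)] ->
  [/\ s = gy, sigma = 1 & e = 0] \/ [/\ s = gz, sigma = 'X%:P & e = 1] ->
  size xi = 2 -> xi - a%:P%:P * tau 1 xi = sigma ->
  forall (gT : finGroupType) (act : gT -> {rmorphism R -> R})
    (t : gT -> gT -> R) (S : lalgType R) (bar : gT -> S),
  automorphism_group act -> crossed_product act t bar -> prime_ring S.
Proof.
move=> tau L0 relsE s_yz xi2 xiE gT act t S bar actG S_cross.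
pose v (i : 'I_3) := nth 0 [:: lau tau xi (- e%:Z); lau tau 1 1; lau tau 'X%:P 0] i.
have phi_rels (phi : {rmorphism free_alg K 3 -> skew_laurent tau}) :
    (forall i, phi (gen K i) = v i) ->
    (forall k u, phi (k *: u) = lau_const tau k%:P%:P * phi u) ->
    forall r, r \in rels -> phi r = 0.
  move=> phi_gen phiZ r; rewrite relsE !inE.
  have phi_x : phi gx = lau tau xi (- e%:Z) := phi_gen _.
  have phi_y : phi gy = lau tau 1 1 := phi_gen _.
  have phi_z : phi gz = lau tau 'X%:P 0 := phi_gen _.
  have phi_s : phi s = lau tau sigma (- e%:Z + 1).
    by case: s_yz => -[-> -> ->].
  have phiC := rmorph_commutator phiZ.
  case/or3P=> /eqP->.
  - rewrite rmorphB phiC phi_s phi_x phi_y lau_skew_commutator rmorph1 mulr1 mul1r.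
    by rewrite xiE subrr.
  - rewrite phiC phi_x phi_z lau_skew_commutator int_act0 tau_z.
    by rewrite [xi * _]mulrC mulrA subrr /lau monalgU0.
  - rewrite phiC phi_y phi_z lau_skew_commutator int_act0 tau_z.
    by rewrite mulr1 mul1r mulr1 subrr /lau monalgU0.
have [iota [iota_gen iota_c]] :=
  presented_model (c := polyC \o polyC) (tau_c L P_or_nu) (v := v) f_surj f_ker
  phi_rels.
have [rel_xy rel_xz rel_yz] : [/\ gx * gy - a *: (gy * gx) - s \in rels,
    gx * gz - q ^ (L * - e%:Z) *: (gz * gx) \in rels &
    gy * gz - q ^ L *: (gz * gy) \in rels].
  by rewrite relsE; exact: mem_triple.
have rel0 r : r \in rels -> f r = 0 by exact: presented_rel.
have xy := lrmorph_commutator (rel0 _ rel_xy).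
have xz := lrmorph_commutator0 (rel0 _ rel_xz).
have yz := lrmorph_commutator0 (rel0 _ rel_yz).
have zy : f gz * f gy = (q ^ L)^-1 *: (f gy * f gz).
  by rewrite yz scalerA mulVf ?expfz_neq0// scale1r.
have iota_x : iota (f gx) = lau tau xi (- e%:Z) := iota_gen _.
have iota_y : iota (f gy) = lau tau 1 1 := iota_gen _.
have iota_z : iota (f gz) = lau tau 'X%:P 0 := iota_gen _.
have f_s : f s \in [:: 0; 1; f gy; f gz].
  by rewrite !inE; case: s_yz => -[-> _ _]; rewrite eqxx ?orbT.
exact: (prime_criterion q_nroot1 xy xz zy f_s three_generated iota_c
  iota_y iota_z (@z_faithful R (f gz)) iota_x xi2 z_neq0 L0 iota_z
  (tau_z _ _) actG S_cross).
Qed.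
End ThreeGenerators.
End Cases.

Lemma unscaled_relations (K : fieldType) (A : lalgType K) (q : K) (x y z : A) :
  [:: x * y - y * x - y; x * z - z * x; y * z - q *: (z * y)] =
  [:: x * y - 1 *: (y * x) - y; x * z - 1 *: (z * x); y * z - q *: (z * y)].
Proof. by rewrite !scale1r. Qed.

(** An element u commuting with y has com u = (1 - q) y u.  As 1 - q is invertible,
    any right-hand side a y z + b y^2 + d y can therefore be produced, or removed,
    by translating w. *)
Lemma commutator_shift (K : fieldType) (A : nzRingType)
    (c : {rmorphism K -> A}) (q a b d : K) (w y z : A) :
  (forall k u, c k * u = u * c k) -> y * z = z * y ->
  let com u := u * y - c q * (y * u) in
  com (w + c a * z + c b * y + c d) = com w + (c (a * (1 - q)) * (y * z)
    + c (b * (1 - q)) * y ^+ 2 + c (d * (1 - q)) * y).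
Proof.
move=> c_central yz com.
have comD u v : com (u + v) = com u + com v.
  by rewrite /com mulrDl mulrDr mulrDr opprD addrACA.
have comZ k u v : u * y = v -> y * u = v -> com (c k * u) = c (k * (1 - q)) * v.
  move=> uy yu; rewrite /com [y * _]mulrA -[y * c k]c_central -!mulrA uy yu mulrA.
  by rewrite -mulrBl -rmorphM -rmorphB mulrBr mulr1 [q * k]mulrC.
rewrite !comD (comZ _ _ (y * z)) ?yz// (comZ _ _ (y ^+ 2)) ?expr2//.
by rewrite -[c d]mulr1 (comZ _ _ y) ?mul1r ?mulr1// !addrA.
Qed.

Lemma rmorph_quadratic (K : fieldType) (A : lalgType K) (T : nzRingType)
    (phi : {rmorphism A -> T}) (c : K -> T) :
  (forall k u, phi (k *: u) = c k * phi u) -> forall q a b d u v w,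
  phi (u * v - q *: (v * u) - (a *: (v * w) + b *: v ^+ 2 + d *: v)) =
  phi u * phi v - c q * (phi v * phi u)
    - (c a * (phi v * phi w) + c b * phi v ^+ 2 + c d * phi v).
Proof.
by move=> phiZ q a b d u v w; rewrite rmorphB (rmorph_commutator phiZ) !rmorphD
  !phiZ rmorphM rmorphXn.
Qed.

Lemma rmorph_comm0 (A T : nzRingType) (phi : {rmorphism A -> T}) (u v : A) :
  phi (u * v - v * u) = phi u * phi v - phi v * phi u.
Proof. by rewrite rmorphB !rmorphM. Qed.

Lemma horner_alg1 (K : fieldType) (R : algType K) (p : {poly K}) :
  horner_alg (1 : R) p = p.[1]%:A.
Proof.
elim/poly_ind: p => [|p k IHp]; first by rewrite rmorph0 horner0 scale0r.
rewrite rmorphD rmorphM /= horner_algX horner_algC IHp hornerMXaddC !mulr1.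
by rewrite scalerDl.
Qed.

Lemma addr3_subr3 (V : zmodType) (a b c d : V) : a + b + c + d - b - c - d = a.
Proof. by apply/eqP; rewrite !subr_eq [X in X == _](ACl (1*4*3*2)). Qed.

Lemma subr3_addr3 (V : zmodType) (a b c d : V) : a - b - c - d + b + c + d = a.
Proof. by rewrite (ACl (1*2*5*3*6*4*7)) /= !subrK. Qed.

Lemma lrmorph_quadratic (K : fieldType) (A : lalgType K) (R : algType K)
    (f : {lrmorphism A -> R}) (q a b d : K) (u v w : A) :
  f (u * v - q *: (v * u) - (a *: (v * w) + b *: v ^+ 2 + d *: v)) = 0 ->
  f u * f v - q%:A * (f v * f u) =
  a%:A * (f v * f w) + b%:A * f v ^+ 2 + d%:A * f v.
Proof.
have fZ k r : f (k *: r) = k%:A * f r by rewrite linearZ mulr_algl.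
by rewrite (rmorph_quadratic fZ) => /eqP; rewrite subr_eq0 => /eqP.
Qed.

Lemma rmorph_commute (A T : nzRingType) (phi : {rmorphism A -> T}) (u v : A) :
  phi (u * v - v * u) = 0 -> phi u * phi v = phi v * phi u.
Proof. by rewrite rmorph_comm0 => /eqP; rewrite subr_eq0 => /eqP. Qed.

Section ShiftedGenerator.
Variables (K : fieldType) (D : idomainType) (tau : int_action D).
Variables (c : {rmorphism K -> D}) (q a b d : K) (w z : D).
Hypothesis c_fixed : forall k n, tau n (c k) = c k.
Hypothesis z_fixed : forall n, tau n z = z.
Hypothesis w_scaled : c q * tau 1 w = w.
Local Notation Y := (lau tau 1 1).
Local Notation Z := (lau tau z 0).

(** The generator x of the last algebra, in terms of a generator w of the quantum
    plane. *)
Definition shifted_generator : skew_laurent tau :=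
  lau tau w 0 + lau tau (c a * z) 0 + lau tau (c b * 1) 1 + lau tau (c d) 0.
Local Notation X := shifted_generator.

Lemma lau_z_central f : f * Z = Z * f.
Proof.
by have := lau_const_central f z_fixed (mulrC z); rewrite /lau_const => ->.
Qed.

Lemma shifted_generator_relation :
  X * Y - lau_const tau (c q) * (Y * X) - (lau_const tau (c (a * (1 - q))) * (Y * Z)
    + lau_const tau (c (b * (1 - q))) * Y ^+ 2
    + lau_const tau (c (d * (1 - q))) * Y) = 0.
Proof.
pose cst : {rmorphism K -> skew_laurent tau} := lau_const tau \o c.
have cst_central k u : cst k * u = u * cst k.
  by apply: lau_const_central => [n|e]; [exact: c_fixed|exact: mulrC].
have XE : X = lau tau w 0 + cst a * Z + cst b * Y + cst d.
  by rewrite /X /cst /= !lau_constM.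
have wY : lau tau w 0 * Y - cst q * (Y * lau tau w 0) = 0.
  rewrite lau_skew_commutator rmorph1 mulr1 mul1r w_scaled subrr.
  exact: monalgU0.
have com_X := commutator_shift q a b d (lau tau w 0) cst_central (lau_z_central Y).
cbv zeta in com_X; rewrite wY add0r -XE in com_X.
by apply/eqP; rewrite subr_eq0; apply/eqP; exact: com_X.
Qed.
End ShiftedGenerator.

Section Algebras.
Variables (K : fieldType) (q : K).
Hypothesis q_neq0 : q != 0.
Hypothesis q_nroot1 : forall n : nat, (0 < n)%N -> q ^+ n != 1.
Local Notation D := {poly {poly K}}.
Variables (R : algType K) (gT : finGroupType) (act : gT -> {rmorphism R -> R}).
Variables (t : gT -> gT -> R) (S : lalgType R) (bar : gT -> S).
Hypothesis actG : automorphism_group act.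
Hypothesis S_cross : crossed_product act t bar.

Lemma size_affine (c : {poly K}) : size ('X + c%:P : D) = 2.
Proof. by rewrite size_polyDl ?size_polyX// ltnS size_polyC_leq1. Qed.

Lemma size_zM (d : D) : size ('X%:P * d) = size d.
Proof. by rewrite mul_polyC size_scale// polyX_eq0. Qed.

(** Here x = w, and the relation between x and y says that tau 1 w = w - 1. *)
Lemma rels_ii_prime : presented_by (rels_ii q) R -> prime_ring S.
Proof.
move=> [f [f_surj f_ker]].
apply: (three_generator_prime (q_neq0 := q_neq0) q_nroot1 f_surj f_ker (a := 1)
  (s := gen K (@Ordinal 3 1 isT)) (sigma := 1) (L := 1) (P := 0) (nu := -1)
  (P_or_nu := or_introl erefl) (e := 0) (xi := 'X) _ _ _ _ _ actG S_cross).
- by [].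
- by rewrite mul1r oppr0 expr0z expr1z; exact: unscaled_relations.
- by left.
- exact: size_polyX.
- rewrite tau_w mul0r expr0z !polyC1 !mul1r mulr1z !polyCN !polyC1; ring.
Qed.

(** Here x = z w y^-1.  The relation between x and y says that tau 1 w = w - 1, as
    the factors q and q^-1 acquired by z cancel. *)
Lemma rels_iii_prime : presented_by (rels_iii q) R -> prime_ring S.
Proof.
move=> [f [f_surj f_ker]].
apply: (three_generator_prime (q_neq0 := q_neq0) q_nroot1 f_surj f_ker (a := q)
  (s := gen K (@Ordinal 3 2 isT)) (sigma := 'X%:P) (L := -1) (P := 0) (nu := -1)
  (P_or_nu := or_introl erefl) (e := 1) (xi := 'X%:P * 'X) _ _ _ _ _ actG S_cross).
- by [].
- by rewrite mulrNN mulr1 expr1z exprN1.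
- by right.
- by rewrite size_zM size_polyX.
- rewrite rmorphM tau_w tau_z mul0r mulr1 expr0z exprN1 !polyC1 mul1r mulr1z.
  rewrite !polyCN !polyC1.
  have q_qV : q%:P%:P * (q^-1)%:P%:P = 1 :> D by rewrite -!polyCM mulfV.
  by rewrite 2!mulrA q_qV; ring.
Qed.

(** Here x = z (w + k) y^-1.  The factors q in the relation and in tau 1 z do not
    cancel, which makes tau 1 an affine map of w of ratio q^-2; the constant k
    moves its fixed point to 0. *)
Lemma rels_iv_prime : presented_by (rels_iv q) R -> prime_ring S.
Proof.
move=> [f [f_surj f_ker]]; pose k := (1 - q ^+ 2)^-1.
have kE : k - q * q * k = 1.
  rewrite -{1}[k]mul1r -mulrBl mulfV// subr_eq0 eq_sym.
  exact: q_nroot1 2 isT.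
apply: (three_generator_prime (q_neq0 := q_neq0) q_nroot1 f_surj f_ker (a := q)
  (s := gen K (@Ordinal 3 2 isT)) (sigma := 'X%:P) (L := 1) (P := -2) (nu := 0)
  (P_or_nu := or_intror erefl) (e := 1) (xi := 'X%:P * ('X + k%:P%:P))
  _ _ _ _ _ actG S_cross).
- by [].
- by rewrite mul1r exprN1 expr1z.
- by right.
- by rewrite size_zM size_affine.
- rewrite rmorphM rmorphD tau_w tau_z tau_c mul0rz !polyC0 addr0 !mulr1 expr1z.
  have qq : q%:P%:P * q%:P%:P * (q ^ (-2))%:P%:P = 1 :> D.
    by rewrite -!polyCM -expr2 -exprnN mulfV// expf_neq0.
  have {}kE : k%:P%:P - q%:P%:P * q%:P%:P * k%:P%:P = 1 :> D.
    by rewrite -!polyCM -!polyCB kE.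
  rewrite [LHS](_ : _ = (1 - q%:P%:P * q%:P%:P * (q ^ (-2))%:P%:P) * ('X%:P * 'X)
    + (k%:P%:P - q%:P%:P * q%:P%:P * k%:P%:P) * 'X%:P); last by ring.
  by rewrite qq kE subrr mul0r add0r mul1r.
Qed.

Lemma one_sub_q : 1 - q != 0.
Proof. by rewrite subr_eq0 eq_sym; exact: (q_nroot1 (n := 1) isT). Qed.

(** The quantum Weyl algebra: x y + 1 / (q - 1) is an eigenvector w for
    conjugation by y, and x = (w + k) y^-1 with k = 1 / (1 - q).  There is no z,
    and 1 takes its place. *)
Lemma rels_i_prime : presented_by (rels_i q) R -> prime_ring S.
Proof.
move=> [f [f_surj f_ker]]; pose k := (1 - q)^-1.
have kE : k - q * k = 1 by rewrite -{1}[k]mul1r -mulrBl mulfV// one_sub_q.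
pose tau := zw_action 0 q_neq0 (P := -1) (nu := 0) (or_intror erefl).
pose xi : D := 'X + k%:P%:P.
pose gx := gen K (@Ordinal 2 0 isT); pose gy := gen K (@Ordinal 2 1 isT).
pose v (i : 'I_2) := nth 0 [:: lau tau xi (- 1%:Z); lau tau 1 1] i.
have one_lau : 1 = lau tau 1 0 by [].
have phi_rels (phi : {rmorphism free_alg K 2 -> skew_laurent tau}) :
    (forall i, phi (gen K i) = v i) ->
    (forall k u, phi (k *: u) = lau_const tau k%:P%:P * phi u) ->
    forall r, r \in rels_i q -> phi r = 0.
  move=> phi_gen phiZ r; rewrite mem_seq1 => /eqP->.
  have phi_x : phi gx = lau tau xi (- 1%:Z) := phi_gen _.
  have phi_y : phi gy = lau tau 1 1 := phi_gen _.
  rewrite rmorphB (rmorph_commutator phiZ) rmorph1 phi_x phi_y.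
  rewrite lau_skew_commutator rmorph1 mulr1 mul1r addNr one_lau -lauB.
  suff -> : xi - q%:P%:P * tau 1 xi - 1 = 0 by rewrite /lau monalgU0.
  rewrite rmorphD tau_w tau_c mul0rz !polyC0 addr0 mulr1 exprN1.
  have q_qV : q%:P%:P * (q^-1)%:P%:P = 1 :> D by rewrite -!polyCM mulfV.
  have {}kE : k%:P%:P - q%:P%:P * k%:P%:P = 1 :> D.
    by rewrite -!polyCM -!polyCB kE.
  rewrite /xi mulrDr mulrA q_qV mul1r opprD addrACA subrr add0r.
  by rewrite kE subrr.
have [iota [iota_gen iota_c]] :=
  presented_model (c := polyC \o polyC) (tau_c q_neq0 0 (or_intror erefl)) (v := v)
    f_surj f_ker phi_rels.
have iota_x : iota (f gx) = lau tau xi (- 1%:Z) := iota_gen _.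
have iota_y : iota (f gy) = lau tau 1 1 := iota_gen _.
have xy : f gx * f gy = q *: (f gy * f gx) + 1.
  rewrite -(rmorph1 f); apply: lrmorph_commutator.
  by apply: (presented_rel f_ker); rewrite mem_seq1.
have xz : f gx * 1 = 1 *: (1 * f gx) by rewrite mulr1 mul1r scale1r.
have zy : 1 * f gy = 1 *: (f gy * 1) by rewrite mulr1 mul1r scale1r.
have s1_w : iota (f gx * f gy - k%:A) = lau tau 'X 0.
  rewrite rmorphB rmorphM iota_x iota_y iota_c lauM addNr rmorph1 mulr1.
  by rewrite -lauB /= addrK.
have faithful p : p \Po 1 = 0 -> horner_alg (1 : R) p = 0.
  rewrite -polyC1 comp_polyCr => /eqP; rewrite polyC_eq0 horner_alg1 => /eqP->.
  by rewrite scale0r.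
have generated (W : R -> Prop) : W 1 ->
    (forall u v, W u -> W v -> W (u + v)) -> (forall k u, W u -> W (k *: u)) ->
    (forall u, W u -> W (f gx * u)) -> (forall u, W u -> W (f gy * u)) ->
    (forall u, W u -> W (1 * u)) -> forall u, W u.
  move=> W1 WD WZ Wx Wy _; apply: (presented_gen_ind f_surj) => // -[[|[|//]] Hi].
  - by rewrite (_ : Ordinal Hi = @Ordinal 2 0 isT)//; apply: val_inj.
  - by rewrite (_ : Ordinal Hi = @Ordinal 2 1 isT)//; apply: val_inj.
have one_in : (1 : R) \in [:: 0; 1; f gy; 1] by rewrite in_cons mem_head orbT.
have w_weight n : tau n 'X = (q ^ (-1 * n))%:P%:P * 'X.
  by rewrite tau_w mul0rz !polyC0 addr0.
have w_neq0 : 'X != 0 :> D by rewrite polyX_eq0.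
exact: (prime_criterion q_nroot1 xy xz zy one_in generated iota_c iota_y
  (rmorph1 iota) faithful iota_x (size_affine _) w_neq0 (isT : (-1 : int) != 0)
  s1_w w_weight actG S_cross).
Qed.

(** Translating x by a combination of z, y and 1 turns the algebra into the
    quantum plane in w and y with a central variable z; the coefficients alpha,
    beta, gamma disappear because 1 - q is invertible. *)
Lemma rels_v_prime (alpha beta gamma : K) :
  presented_by (rels_v q alpha beta gamma) R -> prime_ring S.
Proof.
move=> [f [f_surj f_ker]].
pose a := alpha / (1 - q); pose b := beta / (1 - q); pose c := gamma / (1 - q).
have aE : alpha = a * (1 - q) by rewrite mulfVK// one_sub_q.
have bE : beta = b * (1 - q) by rewrite mulfVK// one_sub_q.
have cE : gamma = c * (1 - q) by rewrite mulfVK// one_sub_q.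
pose tau := zw_action 0 q_neq0 (P := -1) (nu := 0) (or_intror erefl).
pose gx := gen K (@Ordinal 3 0 isT); pose gy := gen K (@Ordinal 3 1 isT).
pose gz := gen K (@Ordinal 3 2 isT).
pose X := shifted_generator tau (polyC \o polyC) a b c 'X 'X%:P.
pose v (i : 'I_3) := nth 0 [:: X; lau tau 1 1; lau tau 'X%:P 0] i.
have tz n : tau n 'X%:P = 'X%:P by rewrite tau_z mul0r expr0z !polyC1 mul1r.
have w_scaled : (polyC \o polyC) q * tau 1 'X = 'X :> D.
  rewrite tau_w mul0rz !polyC0 addr0 mulr1 exprN1 mulrA /= -!polyCM mulfV//.
  by rewrite !polyC1 mul1r.
have phi_rels (phi : {rmorphism free_alg K 3 -> skew_laurent tau}) :
    (forall i, phi (gen K i) = v i) ->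
    (forall k u, phi (k *: u) = lau_const tau k%:P%:P * phi u) ->
    forall r, r \in rels_v q alpha beta gamma -> phi r = 0.
  move=> phi_gen phiZ r; rewrite /rels_v !inE.
  have phi_x : phi gx = X := phi_gen _.
  have phi_y : phi gy = lau tau 1 1 := phi_gen _.
  have phi_z : phi gz = lau tau 'X%:P 0 := phi_gen _.
  case/or3P=> /eqP->.
  - rewrite (rmorph_quadratic phiZ) phi_x phi_y phi_z aE bE cE.
    have XY := @shifted_generator_relation K D tau (polyC \o polyC) q a b c
      (polyX _) (polyC (polyX K)) (tau_c _ _ _) tz w_scaled.
    exact: XY.
  - by rewrite rmorph_comm0 phi_x phi_z (lau_z_central tz) subrr.
  - by rewrite rmorph_comm0 phi_y phi_z (lau_z_central tz) subrr.
have [iota [iota_gen iota_c]] :=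
  presented_model (c := polyC \o polyC) (tau_c q_neq0 0 (or_intror erefl)) (v := v)
    f_surj f_ker phi_rels.
have iota_x : iota (f gx) = X := iota_gen _.
have iota_y : iota (f gy) = lau tau 1 1 := iota_gen _.
have iota_z : iota (f gz) = lau tau 'X%:P 0 := iota_gen _.
pose x' := f gx - a *: f gz - b *: f gy - c%:A.
have iota_x' : iota x' = lau tau 'X (- 0%:Z).
  rewrite !rmorphB (embedded_scale iota_c _ iota_z) (embedded_scale iota_c _ iota_y).
  by rewrite iota_x iota_c addr3_subr3.
have rel0 r : r \in rels_v q alpha beta gamma -> f r = 0 by exact: presented_rel.
have [rel_xy rel_xz rel_yz] := mem_triple
  (gx * gy - q *: (gy * gx) - (alpha *: (gy * gz) + beta *: gy ^+ 2 + gamma *: gy))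
  (gx * gz - gz * gx) (gy * gz - gz * gy).
pose x := f gx; pose y := f gy; pose z := f gz.
have yz : y * z = z * y := rmorph_commute (rel0 _ rel_yz).
have xz : x * z = z * x := rmorph_commute (rel0 _ rel_xz).
have xy := lrmorph_quadratic (rel0 _ rel_xy); rewrite -/x -/y -/z in xy.
have xE : x = x' + a%:A * z + b%:A * y + c%:A.
  by rewrite !mulr_algl subr3_addr3.
have x'y : x' * y = q *: (y * x') + 0.
  have A_central k (u : R) : k%:A * u = u * k%:A by rewrite mulr_algl mulr_algr.
  have com_x := commutator_shift q a b c x' (c := in_alg R) A_central yz.
  cbv zeta in com_x; rewrite /= -xE xy -aE -bE -cE in com_x.
  apply/eqP; rewrite addr0 -subr_eq0 -mulr_algl; apply/eqP.
  by apply: (addIr (alpha%:A * (y * z) + beta%:A * y ^+ 2 + gamma%:A * y));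
    rewrite add0r.
have x'z : x' * z = 1 *: (z * x').
  rewrite scale1r !mulrBl !mulrBr -!scalerAl -!scalerAr mul1r mulr1.
  by rewrite -/x -/y -/z xz yz.
have zy : z * y = 1 *: (y * z) by rewrite scale1r.
have generated (W : R -> Prop) : W 1 ->
    (forall u v, W u -> W v -> W (u + v)) -> (forall k u, W u -> W (k *: u)) ->
    (forall u, W u -> W (x' * u)) -> (forall u, W u -> W (y * u)) ->
    (forall u, W u -> W (z * u)) -> forall u, W u.
  move=> W1 WD WZ Wx' Wy Wz; apply: (three_generated f_surj) => // u Wu.
  rewrite -/x xE 3!mulrDl -2!mulrA !mulr_algl.
  exact: (WD _ _ (WD _ _ (WD _ _ (Wx' _ Wu) (WZ _ _ (Wz _ Wu))) (WZ _ _ (Wy _ Wu)))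
    (WZ _ _ Wu)).
have zero_in : (0 : R) \in [:: 0; 1; y; z] by exact: mem_head.
have w_neq0 : 'X != 0 :> D by rewrite polyX_eq0.
have w_weight n : tau n 'X = (q ^ (-1 * n))%:P%:P * 'X.
  by rewrite tau_w mul0rz !polyC0 addr0.
exact: (prime_criterion q_nroot1 x'y x'z zy zero_in generated iota_c iota_y
  iota_z (@z_faithful _ _ z) iota_x' (size_polyX _) w_neq0 (isT : (-1 : int) != 0)
  iota_x' w_weight actG S_cross).
Qed.
End Algebras.

Theorem corollary4p6 (K : fieldType) (q : K)
    (q_neq0 : q != 0) (q_nroot1 : forall n : nat, (0 < n)%N -> q ^+ n != 1)
    (R : algType K)
    (R_cases :
      presented_by (rels_i q) R \/
      presented_by (rels_ii q) R \/
      ([pchar K] =i pred0 /\ presented_by (rels_iii q) R) \/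
      presented_by (rels_iv q) R \/
      (exists alpha beta gamma : K,
         presented_by (rels_v q alpha beta gamma) R))
    (gT : finGroupType) (act : gT -> {rmorphism R -> R})
    (actG : automorphism_group act)
    (t : gT -> gT -> R) (S : lalgType R) (bar : gT -> S)
    (S_cross : crossed_product act t bar) :
  prime_ring S.
Proof.
case: R_cases => [R_i|[R_ii|[[_ R_iii]|[R_iv|[alpha [beta [gamma R_v]]]]]]].
- exact: (rels_i_prime q_neq0 q_nroot1 actG S_cross R_i).
- exact: (rels_ii_prime q_neq0 q_nroot1 actG S_cross R_ii).
- exact: (rels_iii_prime q_neq0 q_nroot1 actG S_cross R_iii).
- exact: (rels_iv_prime q_neq0 q_nroot1 actG S_cross R_iv).
- exact: (rels_v_prime q_neq0 q_nroot1 actG S_cross R_v).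
Qed.
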